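(* Fix $j\in\Omega$ and put $R=\mathbb{C}[X,Y,P_j^{-1}]$, where $P_j$ is a ground form of the polyhedral group $\Gamma$. For $k\in 2\mathbb{Z}$, the $R^{\Gamma}_0$-module $R^{\Gamma}_k$ is cyclic and generated by $$P_k=P_j^{\nu_j\ell}\prod_{i\in\Omega}P_i^{\mathrm{res}_i(k/2)},\qquad \ell=\frac{k-\sum_{i\in\Omega}\mathrm{res}_i(k/2)\,d_i}{|\Gamma|},$$ where $\mathrm{res}_i(m)\in\{0,1,\ldots,\nu_i-1\}$ denotes the residue of the integer $m$ modulo $\nu_i$. For $k\in 2\mathbb{Z}+1$ we have $R^{B\Gamma}_k=\{0\}$.
   Context: $\Gamma\subset \mathrm{SO}(3)$ is a polyhedral group, i.e. a finite subgroup, and $B\Gamma\subset\mathrm{SU}(2)$ is its full preimage under the double cover $\mathrm{SU}(2)\to\mathrm{SO}(3)$; so $-\mathrm{Id}\in B\Gamma$ and $\Gamma\cong B\Gamma/\{\pm\mathrm{Id}\}$. The group $\Gamma$ acts on the Riemann sphere, identified with the complex projective line of lines in $\mathbb{C}^2$. $\Omega$ is an index set for the $\Gamma$-orbits $S_i$ ($i\in\Omega$) on the sphere whose elements have nontrivial stabiliser in $\Gamma$; $d_i=|S_i|$ and $\nu_i$ is the order of the stabiliser of an element of $S_i$, so $d_i\nu_i=|\Gamma|$. A ground form $P_i\in\mathbb{C}[X,Y]$ is a homogeneous polynomial of degree $d_i$ vanishing on (the lines corresponding to) $S_i$; it is unique up to a nonzero scalar and is relatively invariant under $B\Gamma$ (each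 $\gamma\in B\Gamma$ multiplies it by a scalar). $B\Gamma$ acts on $\mathbb{C}[X,Y]$ by linear substitutions, $(\gamma f)(v)=f(\gamma^{-1}v)$ for $v=(X,Y)^T$, and hence on $R$. $R_k$ is the subspace of $R$ of elements of homogeneous degree $k\in\mathbb{Z}$, and $R_k^{B\Gamma}$ its space of $B\Gamma$-invariants; for $k$ even the action of $B\Gamma$ on $R_k$ factors through $\Gamma$ and one writes $R_k^\Gamma$. *)

(* Defs.v *)
From HB Require Import structures.
From mathcomp Require Import all_boot all_order all_algebra.
From mathcomp Require Import finmap complex.
From mathcomp Require Import mpoly.
From mathcomp Require Import classical_sets reals.

Set Implicit Arguments.
Unset Strict Implicit.
Unset Printing Implicit Defensive.

Import Order.TTheory GRing.Theory Num.Theory.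

Local Open Scope fset_scope.
Local Open Scope complex_scope.
Local Open Scope ring_scope.
Local Open Scope sesquilinear_scope.

Notation "x %:F" := (@FracField.tofrac _ x) : ring_scope.

Section Rotations.
Variable R : realType.
Implicit Types (g : 'M[R[i]]_2) (A : 'M[R]_3) (x : 'cV[R]_3).

Definition SO3 A : Prop := A^T *m A = 1%:M /\ \det A = 1.

Definition SU2 g : Prop := g \is unitarymx /\ \det g = 1.

(* The identification of R^3 with the traceless Hermitian 2 x 2 matrices:
   herm x = x_0 sigma_x + x_1 sigma_y + x_2 sigma_z (Pauli matrices). *)
Definition herm x : 'M[R[i]]_2 :=
  \matrix_(a, b)
    if a == 0 then if b == 0 then (x 2 0)%:C else x 0 0 -i* x 1 0
    else if b == 0 then x 0 0 +i* x 1 0 else (- x 2 0)%:C.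

(* The double cover SU(2) -> SO(3), i.e. the matrix of the conjugation action
   of g on traceless Hermitian matrices: herm (so3_of g *m x) is equal to
   g *m herm x *m g ^t*.  The Pauli matrices herm (delta_mx a 0) are orthogonal
   of norm 2 for the form \tr (M *m N), hence the coefficient formula. *)
Definition so3_of g : 'M[R]_3 :=
  \matrix_(a, b)
    (complex.Re (\tr (herm (delta_mx a 0) *m
                        (g *m herm (delta_mx b 0) *m g ^t*))) / 2).

Definition polyhedral (Gamma : {fset 'M[R]_3}) : Prop :=
  [/\ {in Gamma, forall A, SO3 A}, 1%:M \in Gamma,
      {in Gamma &, forall A B, A *m B \in Gamma}
    & {in Gamma, forall A, invmx A \in Gamma}].

Definition binary (Gamma : {fset 'M[R]_3}) : set 'M[R[i]]_2 :=
  [set g | SU2 g /\ so3_of g \in Gamma].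

(* The Riemann sphere is the unit sphere of R^3, with SO(3) acting by
   rotations.  It is identified with the set of lines of C^2 by sending x to
   the eigenline of herm x for the eigenvalue 1 (an inverse stereographic
   projection).  Since herm (so3_of g *m x) = g *m herm x *m g ^t*, the line of
   so3_of g *m x is the image by g of the line of x. *)
Definition on_sphere x : Prop := x^T *m x = 1%:M.

Definition line_of x : set 'cV[R[i]]_2 := [set v | herm x *m v = v].

Definition orbit_of (Gamma : {fset 'M[R]_3}) x : {fset 'cV[R]_3} :=
  [fset A *m x | A in Gamma].

Definition stab (Gamma : {fset 'M[R]_3}) x : {fset 'M[R]_3} :=
  [fset A in Gamma | A *m x == x].

(* S indexes, without repetition, the Gamma-orbits on the sphere whose elements
   have a nontrivial stabiliser. *)
Definition exceptional_orbits (Gamma : {fset 'M[R]_3}) (Omega : finType)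
    (S : Omega -> {fset 'cV[R]_3}) : Prop :=
  [/\ injective S,
      forall i, exists x,
        [/\ on_sphere x, (1 < #|` stab Gamma x|)%N & S i = orbit_of Gamma x]
    & forall x, on_sphere x -> (1 < #|` stab Gamma x|)%N ->
        exists i, S i = orbit_of Gamma x].

End Rotations.

Section Forms.
Variable R : realType.
Implicit Types (g : 'M[R[i]]_2) (p P : {mpoly R[i][2]}).

Definition ground_form (S : {fset 'cV[R]_3}) P : Prop :=
  [/\ P != 0, P \is #|` S|.-homog
    & forall x v, x \in S -> line_of x v -> P.@[fun a => v a 0] = 0].

(* (g p)(v) = p (g^-1 v) *)
Definition poly_act g p : {mpoly R[i][2]} :=
  p \mPo [tuple \sum_b invmx g a b *: 'X_b | a < 2].

(* The extension of poly_act to C(X, Y); for invertible g it does not depend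
   on the representative n / d that repr picks. *)
Definition frac_act g (f : {fraction {mpoly R[i][2]}}) :
    {fraction {mpoly R[i][2]}} :=
  (poly_act g \n_(repr f))%:F / (poly_act g \d_(repr f))%:F.

(* For P homogeneous and nonzero, the component of degree k of the localisation
   C[X, Y, P^-1], seen inside C(X, Y). *)
Definition loc_homog P (k : int) : set {fraction {mpoly R[i][2]}} :=
  [set f | exists p n (e d : nat),
    [/\ p \is e.-homog, P \is d.-homog, k = e%:Z - (n * d)%N%:Z
      & f = p%:F / P%:F ^+ n]].

(* The invariants of degree k of C[X, Y, P^-1] under the preimage of Gamma. *)
Definition loc_inv P (Gamma : {fset 'M[R]_3}) (k : int) :
    set {fraction {mpoly R[i][2]}} :=
  [set f | loc_homog P k f /\ forall g, binary Gamma g -> frac_act g f = f].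

End Forms.

(* Main.v *)
Require Import Defs.
From HB Require Import structures.
From mathcomp Require Import all_boot all_order all_algebra.
From mathcomp Require Import finmap complex mpoly.
From mathcomp Require Import classical_sets reals.
From mathcomp Require Import ring lra zify.

Set Implicit Arguments.
Unset Strict Implicit.
Unset Printing Implicit Defensive.

Import Order.TTheory GRing.Theory Num.Theory.

Local Open Scope fset_scope.
Local Open Scope classical_set_scope.
Local Open Scope complex_scope.
Local Open Scope ring_scope.

(** The statement is a computation of orders of vanishing on the projective line.

Let g in SU(2) have an eigenvector v with eigenvalue z, and let p be a form of
degree d with order of vanishing a along the line of v, so that
p = line_form v ^ a * q with q v <> 0.  As det g = 1, g multiplies line_form v
by z, and it multiplies the value at v of a form of degree d - a by z^(a - d).
Hence if g multiplies p by a scalar, this scalar is z^(2a - d)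
(semi_invariant_weight), and the same formula holds for quotients of forms.

Let x be a point of the sphere with v on its line.  Sending a rotation fixing x
to z^2, where z is the eigenvalue at v of a lift, is an injective character of
the stabiliser of x; its values are therefore exactly the roots of unity of
order dividing nu, the order of the stabiliser (stab_roots).  Two things follow,
for k = 2m.  An invariant element of degree k has order congruent to m modulo
nu_i at the points of S_i.  Conversely, a homogeneous element of degree k that
each g multiplies by a scalar, and whose order at the points of every S_i is
congruent to m modulo nu_i, is invariant, because every g fixes some exceptional
point (binary_fixes_exceptional).

A ground form is a product of the linear forms of the points of its orbit
(ground_factor), so it vanishes to order exactly 1 on its orbit and nowhere
else, and it is a semi-invariant (ground_weight).  The proposed generator has
order the residue of m at the points of S_i for i <> j, and this residue plus a
multiple of nu_j at those of S_j, so it is invariant (generator_inv).  An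
invariant f of degree k has at the points of S_i, i <> j, an order at least this
residue, so that f is divisible by the product of the P_i^res_i(m) for i <> j
(order_ge_residue, forms_dvd); as P_j is invertible, f divided by the generator
stays in the localisation, and it is invariant of degree 0 (loc_inv_even).

That the exponent l is an integer comes from counting the pairs of a nontrivial
rotation of Gamma and a fixed point: each rotation has two of them, whence
sum_i d_i (nu_i - 1) = 2 (|Gamma| - 1) (riemann_hurwitz), so that sum_i d_i is
2 modulo |Gamma|; and res_i(m) d_i is m d_i modulo |Gamma| because
d_i nu_i = |Gamma| (orbit_stabilizer).

In odd degree, -1 belongs to the binary group and acts as -1
(loc_inv_odd). *)

(** * Binary forms and their linear factors *)

Section BinaryForms.
Variable K : fieldType.
Implicit Types (p q : {mpoly K[2]}) (v w : 'cV[K]_2).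

(** The form w |-> det (v | w). *)
Definition line_form v : {mpoly K[2]} := v 0 0 *: 'X_1 - v 1 0 *: 'X_0.

Lemma dhomogXU (a : 'I_2) : ('X_a : {mpoly K[2]}) \is 1.-homog.
Proof. by rewrite dhomogX /= mdeg1. Qed.

Lemma line_form_homog v : line_form v \is 1.-homog.
Proof. by rewrite /line_form rpredB ?rpredZ ?dhomogXU. Qed.

Lemma line_formE v w : (line_form v).@[w^~ 0] = v 0 0 * w 1 0 - v 1 0 * w 0 0.
Proof. by rewrite /line_form mevalB !mevalZ !mevalXU. Qed.

Lemma line_form_self v : (line_form v).@[v^~ 0] = 0.
Proof. by rewrite line_formE; ring. Qed.

Lemma cV2_neq0 v : v != 0 -> exists a b : 'I_2, a != b /\ v a 0 != 0.
Proof.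
move=> v0; have [v00|] := eqVneq (v 0 0) 0; last by exists 0, 1.
exists 1, 0; split => //; apply: contra_neq v0 => v10.
apply/colP => -[[|[|//]] Hi]; rewrite mxE.
  by rewrite -v00; congr (v _ _); apply/val_inj.
by rewrite -v10; congr (v _ _); apply/val_inj.
Qed.

Lemma big_ord2_neq (T : Type) (idx : T) (op : Monoid.com_law idx)
  (F : 'I_2 -> T)
    (a b : 'I_2) : a != b -> \big[op/idx]_i F i = op (F a) (F b).
Proof.
move=> ab; rewrite (bigD1 a) //= (bigD1 b) 1?eq_sym //= big1 ?Monoid.mulm1 // =>
  i.
by case: a b i ab => [[|[|//]] ?] [[|[|//]] ?] [[|[|//]] ?].
Qed.

Lemma I2P (a : 'I_2) : a = 0 \/ a = 1.
Proof. by case: a => [[|[|//]] ?]; [left|right]; apply/val_inj. Qed.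

Lemma line_form_swap v a b : a != b ->
  exists2 s : K, s != 0 & v a 0 *: 'X_b - v b 0 *: 'X_a = s *: line_form v.
Proof.
case: (I2P a) => ->; case: (I2P b) => ->; rewrite ?eqxx // => _.
- by exists 1; [exact: oner_neq0 | rewrite scale1r].
- by exists (-1); [rewrite oppr_eq0 oner_neq0 | rewrite scaleN1r /line_form
  opprB].
Qed.

(** The congruence modulo line_form v for one monomial: with y = v_b and x =
    v_a, the difference of k-th powers is a multiple of x B - y A. *)
Lemma scale_monomial (L : comAlgType K) (x y : K) (A B : L) i k :
  x ^+ (i + k) *: (A ^+ i * B ^+ k) =
  (x *: A) ^+ i * ((x *: B) ^+ k - (y *: A) ^+ k) +
  (x ^+ i * y ^+ k) *: A ^+ (i + k).
Proof.
rewrite mulrBr !exprZn -!scalerAl -!scalerAr !scalerA.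
by rewrite -!exprD subrK.
Qed.

(** Modulo line_form v the variables satisfy v_a X_b = v_b X_a, so if v_a <> 0
    the form v_a^d p is congruent to p(v) X_a^d. The cofactor is computed
    monomial by monomial, which shows that it is homogeneous. *)
Lemma line_form_factor p d v : v != 0 -> p \is d.-homog -> p.@[v^~ 0] = 0 ->
  exists2 q, p = line_form v * q & q \is d.-1.-homog.
Proof.
move=> /cV2_neq0 [a] [b] [ab va] hp pv0.
have [s s0 hs] := line_form_swap v ab.
pose E := v a 0 *: ('X_b : {mpoly K[2]});
  pose G := v b 0 *: ('X_a : {mpoly K[2]}).
(* E and G are congruent modulo line_form v, and h m is the cofactor for X^m. *)
pose h (m : 'X_{1..2}) : {mpoly K[2]} :=
  (v a 0 *: 'X_a) ^+ m a * \sum_(i < m b) E ^+ ((m b).-1 - i) * G ^+ i.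
have aux (A l B : {mpoly K[2]}) : s *: (l * (A * B)) = A * ((s *: l) * B).
  by rewrite -scalerAl -scalerAr mulrCA.
have hmon m : m \in msupp p ->
    (v a 0) ^+ d *: 'X_[m] =
    s *: (line_form v * h m) + (\prod_(i < 2) v i 0 ^+ m i) *: 'X_a ^+ d.
  move=> /(dhomog_mf hp) /= <-; rewrite mpolyXE_id mdegE.
  rewrite !(big_ord2_neq _ _ ab) /=.
  by rewrite /h aux -hs -/E -/G -subrXX (scale_monomial _ (v b 0)).
exists ((v a 0 ^- d * s) *: \sum_(m <- msupp p) p@_m *: h m).
  apply: (@scalerI _ _ (v a 0 ^+ d)); first by rewrite expf_neq0.
  rewrite -scalerAr scalerA mulrA divff ?expf_neq0 // mul1r.
  rewrite {1}[p]mpolyE scaler_sumr mulr_sumr scaler_sumr.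
  rewrite -[RHS]addr0 -[X in _ = _ + X](scale0r ('X_a ^+ d)) -pv0 mevalE.
  rewrite scaler_suml -big_split /=; apply: eq_big_seq => m /hmon hm.
  rewrite scalerA mulrC -scalerA hm scalerDr -scalerAr !scalerA.
  by rewrite [s * _]mulrC.
apply/rpredZ; rewrite big_seq; apply/rpred_sum => m hm; apply/rpredZ.
rewrite /h mulr_sumr; apply/rpred_sum => i _.
have -> : d.-1 = (1 * m a + (1 * ((m b).-1 - i) + 1 * i))%N.
  rewrite -(dhomog_mf hp hm) /= mdegE (big_ord2_neq _ _ ab) /=.
  by have := ltn_ord i; lia.
by do !apply: dhomogM; apply/dhomogMn/rpredZ/dhomogXU.
Qed.

Lemma homog0_const p : p \is 0.-homog -> exists c, p = c%:MP.
Proof.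
move=> hp; exists p@_0%MM; apply/mpolyP => m; rewrite mcoeffC.
have [->|m0] := eqVneq 0%MM m; first by rewrite mulr1.
rewrite mulr0 (dhomog_nemf_coeff hp) //=.
by rewrite mdeg_eq0 eq_sym.
Qed.

(** The exponent a is the order of vanishing of p along the line of v. *)
Lemma homog_order p d v : v != 0 -> p != 0 -> p \is d.-homog ->
  exists a q, [/\ p = line_form v ^+ a * q, (a <= d)%N, q \is (d - a).-homog
    & q.@[v^~ 0] != 0].
Proof.
move=> v0; elim: d p => [|d IH] p p0 hp.
  exists 0%N, p; split; rewrite ?expr0 ?mul1r //.
  have [c pc] := homog0_const hp; move: p0; rewrite pc mevalC.
  by apply: contra_neq => ->; rewrite mpolyC0.
have [pv|pv] := eqVneq p.@[v^~ 0] 0; last first.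
  by exists 0%N, p; split; rewrite ?expr0 ?mul1r ?subn0.
have [q pq hq] := line_form_factor v0 hp pv.
have q0 : q != 0 by apply: contra_neq p0; rewrite pq => ->; rewrite mulr0.
have [a [r [qr ad hr rv]]] := IH q q0 hq.
by exists a.+1, r; split; rewrite ?subSS // pq qr exprS mulrA.
Qed.

Lemma line_form_neq0 v : v != 0 -> line_form v != 0.
Proof.
move=> v0; apply: contra_neq v0 => l0.
have h w : v 0 0 * w 1 0 - v 1 0 * w 0 0 = 0 by rewrite -line_formE l0 meval0.
have := h (delta_mx 1 0); have := h (delta_mx 0 0).
rewrite !mxE /= !mulr0 !mulr1 subr0 sub0r => /eqP;
  rewrite oppr_eq0 => /eqP v1 v0.
by apply/colP => k; rewrite mxE; case: (I2P k) => ->.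
Qed.

(** A linear form is prime: a factor b that does not vanish at v contributes
    nothing to the power of line_form v, as evaluation at v shows. *)
Lemma line_form_exp_dvd v m d (p b q : {mpoly K[2]}) : v != 0 ->
  b.@[v^~ 0] != 0 ->
  q \is d.-homog -> line_form v ^+ m * p = b * q ->
  exists2 q', q = line_form v ^+ m * q' & q' \is (d - m).-homog.
Proof.
move=> v0 bv; elim: m d q => [|m IH] d q hq e.
  by exists q; rewrite ?expr0 ?mul1r ?subn0.
have qv : q.@[v^~ 0] = 0.
  have := congr1 (meval (v^~ 0)) e; rewrite exprS -mulrA !mevalM line_form_self
    mul0r.
  by move/esym/eqP; rewrite mulf_eq0 (negPf bv) => /eqP.
have [q1 qq1 hq1] := line_form_factor v0 hq qv.
case: (IH d.-1 q1 hq1) => [|q2 q12 hq2].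
  apply: (mulfI (line_form_neq0 v0)); rewrite mulrA -exprS e qq1; exact: mulrCA.
exists q2; first by rewrite qq1 q12 exprS mulrA.
by rewrite (_ : d - m.+1 = d.-1 - m)%N //; lia.
Qed.

(** Powers of pairwise non-proportional linear forms are coprime, so dividing by
    each of them separately is dividing by their product. *)
Lemma line_form_prod_dvd (T : eqType) (s : seq T) (V : T -> 'cV[K]_2)
  (m : T -> nat) d p :
  uniq s -> {in s, forall t, V t != 0} ->
  {in s &, forall t u, t != u -> (line_form (V t)).@[(V u)^~ 0] != 0} ->
  p \is d.-homog -> {in s, forall t, exists q, p = line_form (V t) ^+ m t * q}
    ->
  exists2 q, p = \prod_(t <- s) line_form (V t) ^+ m t * q
    & q \is (d - \sum_(t <- s) m t).-homog.
Proof.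
move=> us V0 Vn hp; elim: s us V0 Vn => [|t s IH] /=.
  by move=> *; exists p; rewrite ?big_nil ?mul1r ?subn0.
move=> /andP[ts us] V0 Vn Vp; case: IH => //.
- by move=> u us'; apply: V0; rewrite inE us' orbT.
- by move=> u w us' ws'; apply: Vn; rewrite inE ?us' ?ws' orbT.
- by move=> u us'; apply: Vp; rewrite inE us' orbT.
move=> q pq hq; have [|r pr] := Vp t; first by rewrite inE eqxx.
rewrite pr in pq; have [||q' qq' hq'] := line_form_exp_dvd _ _ hq pq.
- by apply: V0; rewrite inE eqxx.
- rewrite rmorph_prod /= prodf_seq_neq0; apply/allP => u us' /=.
  rewrite rmorphXn /= expf_neq0 //; apply: Vn; rewrite ?inE ?eqxx ?us' ?orbT //.
  by apply: contraNneq ts => <-.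
exists q'; first by rewrite pr pq qq' big_cons; ring.
by rewrite big_cons addnC subnDA.
Qed.

End BinaryForms.

(** * Elements of a fraction field as quotients *)

Section Fractions.
Variable D : idomainType.
Implicit Type f : {fraction D}.

(** Relates the numerator and denominator of the chosen representative to the
    division of the fraction field. *)
Lemma frac_numden f : f = (\n_(repr f))%:F / (\d_(repr f))%:F.
Proof.
rewrite -[LHS]reprK; set x := repr f; unlock FracField.tofrac.
rewrite -[X in _ * X]FracField.pi_inv -[RHS]FracField.pi_mul.
rewrite /FracField.mulf /FracField.invf !numden_Ratio ?oner_neq0 //.
- by rewrite mulr1 mul1r Ratio_numden.
all: exact: denom_ratioP.
Qed.

Lemma eq_frac (p1 q1 p2 q2 : D) : q1 != 0 -> q2 != 0 ->
  p1%:F / q1%:F = p2%:F / q2%:F <-> p1 * q2 = p2 * q1.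
Proof.
move=> h1 h2.
have k1 : q1%:F != 0 by rewrite tofrac_eq0.
have k2 : q2%:F != 0 by rewrite tofrac_eq0.
split=> [/eqP|e].
  by rewrite eqr_div // -!tofracM tofrac_eq => /eqP.
by apply/eqP; rewrite eqr_div // -!tofracM e.
Qed.

Lemma fraction_exists f : exists p q : D, q != 0 /\ f = p%:F / q%:F.
Proof.
by exists \n_(repr f), \d_(repr f); split;
  [exact: denom_ratioP | exact: frac_numden].
Qed.

Lemma tofrac_div1 (p : D) : p%:F / 1%:F = p%:F.
Proof. by rewrite tofrac1 divr1. Qed.

Lemma tofrac0_div (q : D) : 0%:F / q%:F = 0.
Proof. by rewrite tofrac0 mul0r. Qed.

End Fractions.

(** * Linear substitutions in forms and rational functions *)

Section Action.
Variable R : realType.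
Local Notation C := R[i].
Implicit Types (g : 'M[C]_2) (p q : {mpoly C[2]}) (v w : 'cV[C]_2).
Implicit Types (f : {fraction {mpoly C[2]}}).

Lemma sum2E (V : nmodType) (F : 'I_2 -> V) : \sum_i F i = F 0 + F 1.
Proof. exact: big_ord2_neq. Qed.

Lemma poly_act_is_additive g : zmod_morphism (poly_act g).
Proof. exact: comp_mpolyB. Qed.
Lemma poly_act_is_monoid g : monoid_morphism (poly_act g).
Proof. split; [exact: rmorph1 | exact: rmorphM]. Qed.
HB.instance Definition _ g := GRing.isZmodMorphism.Build _ _ (poly_act g)
  (poly_act_is_additive g).
HB.instance Definition _ g := GRing.isMonoidMorphism.Build _ _ (poly_act g)
  (poly_act_is_monoid g).

Lemma poly_act1 g : poly_act g 1 = 1.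
Proof. exact: comp_mpoly1. Qed.

Lemma poly_actZ g c p : poly_act g (c *: p) = c *: poly_act g p.
Proof. exact: comp_mpolyZ. Qed.

Lemma poly_actX g a : poly_act g 'X_a = \sum_b invmx g a b *: 'X_b.
Proof. by rewrite /poly_act comp_mpolyXU -tnth_nth tnth_mktuple. Qed.

Lemma poly_actE g p v : (poly_act g p).@[v^~ 0] = p.@[(invmx g *m v)^~ 0].
Proof.
rewrite /poly_act comp_mpoly_meval; apply: meval_eq => a.
rewrite tnth_mktuple raddf_sum mxE; apply: eq_bigr => b _ /=.
by rewrite mevalZ mevalXU.
Qed.

Lemma poly_act_homog g d p : p \is d.-homog -> poly_act g p \is d.-homog.
Proof.
move=> hp; rewrite /poly_act comp_mpolyEX big_seq; apply/rpred_sum => m hm.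
apply/rpredZ; rewrite comp_mpolyX.
rewrite -(dhomog_mf hp hm) /= mdegE.
apply: (big_rec2 (fun (q : {mpoly C[2]}) k => q \is k.-homog));
  first exact: dhomog1.
move=> i k q _ hq; apply: dhomogM hq; rewrite tnth_mktuple.
have /(dhomogMn (m i)) : (\sum_b invmx g i b *: 'X_b : {mpoly C[2]}) \is
  1.-homog.
  by apply/rpred_sum => b _; apply/rpredZ/dhomogXU.
by rewrite mul1n.
Qed.

Lemma poly_actK g : g \in unitmx -> cancel (poly_act g) (poly_act (invmx g)).
Proof.
move=> gu p; rewrite [poly_act g p]comp_mpolyEX raddf_sum /= [RHS]mpolyE.
apply: eq_bigr => m _; rewrite poly_actZ comp_mpolyX rmorph_prod /= mpolyXE_id.
congr (_ *: _); apply: eq_bigr => a _; rewrite rmorphXn /=; congr (_ ^+ _).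
rewrite tnth_mktuple raddf_sum /=.
transitivity (\sum_c (invmx g *m invmx (invmx g)) a c *: ('X_c : {mpoly C[2]})).
  under eq_bigr do rewrite poly_actZ poly_actX scaler_sumr.
  rewrite exchange_big; apply: eq_bigr => c _ /=.
  by rewrite mxE scaler_suml; apply: eq_bigr => b _; rewrite scalerA.
rewrite mulmxV ?unitmx_inv // sum2E !mxE.
by case: (I2P a) => ->; rewrite /= scale1r scale0r ?addr0 ?add0r.
Qed.

Lemma poly_act_eq0 g p : g \in unitmx -> (poly_act g p == 0) = (p == 0).
Proof.
move=> gu; apply/eqP/eqP => [e|->]; last exact: raddf0.
by rewrite -(poly_actK gu p) e raddf0.
Qed.

Lemma invmx2 g : \det g = 1 ->
  [/\ invmx g 0 0 = g 1 1, invmx g 0 1 = - g 0 1, invmx g 1 0 = - g 1 0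
    & invmx g 1 1 = g 0 0].
Proof.
move=> dg; rewrite /invmx unitmxE dg unitr1 invr1 scale1r !mxE /cofactor
  !det_mx11 !mxE /=.
have -> : lift 0 0 = 1 :> 'I_2 by apply/val_inj.
have -> : lift 1 0 = 0 :> 'I_2 by apply/val_inj.
by split; rewrite ?addn0 ?add0n ?expr0 ?expr1 ?sqrrN ?expr1n ?mul1r ?mulN1r.
Qed.

(** The coefficients of det (v | g^-1 w) when g v = z v, x and y being the
    variables. *)
Lemma scale_det2 (V : lmodType C) (x y : V) (a b c d v0 v1 z : C) :
  a * v0 + b * v1 = z * v0 -> c * v0 + d * v1 = z * v1 ->
  v0 *: (- c *: x + a *: y) - v1 *: (d *: x + - b *: y) =
  z *: (v0 *: y - v1 *: x).
Proof.
move=> e0 e1; rewrite scalerBr !scalerDr !scalerA -e0 -e1 !mulrN !scaleNr.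
rewrite opprD opprK !scalerDl opprD addrACA addrC.
by rewrite [v0 * a]mulrC [v1 * b]mulrC [v0 * c]mulrC [v1 * d]mulrC.
Qed.

(** For det g = 1, det (v | g^-1 w) = det (g v | w). *)
Lemma poly_act_line_form g v z : \det g = 1 -> g *m v = z *: v ->
  poly_act g (line_form v) = z *: line_form v.
Proof.
move=> dg /colP gv; have [h00 h01 h10 h11] := invmx2 dg.
rewrite /line_form [LHS]raddfB /= !poly_actZ !poly_actX !sum2E h00 h01 h10 h11.
have := gv 0; have := gv 1; rewrite !mxE !sum2E => e1 e0.
exact: scale_det2.
Qed.

Lemma homog_eval_scale d p c v : p \is d.-homog ->
  p.@[(c *: v)^~ 0] = c ^+ d * p.@[v^~ 0].
Proof.
move=> hp; rewrite !mevalE mulr_sumr; apply: eq_big_seq => m hm.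
rewrite mulrCA -(dhomog_mf hp hm) /= mdegE -prodrXr -big_split /=.
by congr (_ * _); apply: eq_bigr => i _; rewrite mxE exprMn.
Qed.

Lemma eigen_neq0 g v z : \det g = 1 -> v != 0 -> g *m v = z *: v -> z != 0.
Proof.
move=> dg v0 gv; apply: contra_neq v0 => z0.
have gu : g \in unitmx by rewrite unitmxE dg unitr1.
by rewrite -[v](mulKmx gu) gv z0 scale0r mulmx0.
Qed.

(** The order of vanishing a at an eigenline of g determines the multiplier of a
    semi-invariant: line_form v contributes z each of the a times it occurs, and
    the remaining factor, of degree d - a, is evaluated at g^-1 v = z^-1 v. *)
Lemma semi_invariant_weight g v z p q a d c : \det g = 1 -> v != 0 ->
  g *m v = z *: v ->
  (a <= d)%N -> p = line_form v ^+ a * q -> q \is (d - a).-homog ->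
    q.@[v^~ 0] != 0 ->
  poly_act g p = c *: p -> c = z ^ (2 * a%:Z - d%:Z).
Proof.
move=> dg v0 gv ad pq hq qv; have z0 := eigen_neq0 dg v0 gv.
have gu : g \in unitmx by rewrite unitmxE dg unitr1.
rewrite pq rmorphM rmorphXn /= (poly_act_line_form dg gv) exprZn -scalerAl
  scalerAr.
rewrite [c *: _]scalerAr => /(mulfI (expf_neq0 _ (line_form_neq0 v0))).
move=> /(congr1 (meval (v^~ 0))); rewrite !mevalZ poly_actE.
have -> : invmx g *m v = z^-1 *: v.
  by rewrite -[v in RHS](mulKmx gu) gv -scalemxAr scalerA mulVf ?scale1r.
rewrite (homog_eval_scale _ _ hq) mulrA => /(mulIf qv) <-.
rewrite exprVn !exprnP invr_expz -expfzDr //; congr (_ ^ _).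
rewrite -subzn //; ring.
Qed.

(** Injectivity of poly_act g keeps denominators nonzero, so that the action
    does not depend on the chosen representative of the fraction. *)
Lemma frac_actE g p q : g \in unitmx -> q != 0 ->
  frac_act g (p%:F / q%:F) = (poly_act g p)%:F / (poly_act g q)%:F.
Proof.
move=> gu q0; rewrite /frac_act.
have := frac_numden (p%:F / q%:F); set r := repr _.
have r0 : \d_r != 0 by exact: denom_ratioP.
move=> /(eq_frac _ _ q0 r0) /(congr1 (poly_act g)); rewrite !rmorphM /= => e.
have gr0 : poly_act g \d_r != 0 by rewrite poly_act_eq0.
have gq0 : poly_act g q != 0 by rewrite poly_act_eq0.
exact: (iffRL (eq_frac _ _ gr0 gq0) (esym e)).
Qed.

Lemma frac_actM g f1 f2 : g \in unitmx ->
  frac_act g (f1 * f2) = frac_act g f1 * frac_act g f2.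
Proof.
move=> gu; have [p1 [q1 [h1 ->]]] := fraction_exists f1;
  have [p2 [q2 [h2 ->]]] := fraction_exists f2.
by rewrite mulf_div -!tofracM !frac_actE ?mulf_neq0 // !rmorphM /= mulf_div.
Qed.

Lemma frac_actV g f : g \in unitmx -> frac_act g f^-1 = (frac_act g f)^-1.
Proof.
move=> gu; have [p [q [q0 ->]]] := fraction_exists f.
have [->|p0] := eqVneq p 0.
  suff h0 : frac_act g 0 = 0 by rewrite tofrac0_div invr0 h0 invr0.
  rewrite -[in LHS](tofrac0_div 1) frac_actE ?oner_neq0 //.
  by rewrite raddf0 tofrac0_div.
by rewrite invf_div !frac_actE // invf_div.
Qed.

Lemma frac_act_tofrac g p : g \in unitmx -> frac_act g p%:F = (poly_act g p)%:F.
Proof.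
move=> gu; have := frac_actE p gu (oner_neq0 _).
by rewrite poly_act1 !tofrac_div1.
Qed.

Definition scalar_frac (c : C) : {fraction {mpoly C[2]}} := (c%:MP_[2])%:F.

Lemma scalar_frac_is_additive : zmod_morphism scalar_frac.
Proof. by move=> x y; rewrite /scalar_frac mpolyCB tofracB. Qed.
Lemma scalar_frac_is_monoid : monoid_morphism scalar_frac.
Proof.
by split=> [|x y]; rewrite /scalar_frac ?mpolyC1 ?tofrac1 // mpolyCM tofracM.
Qed.
HB.instance Definition _ := GRing.isZmodMorphism.Build _ _ scalar_frac
  scalar_frac_is_additive.
HB.instance Definition _ := GRing.isMonoidMorphism.Build _ _ scalar_frac
  scalar_frac_is_monoid.

Lemma tofracZ c p : (c *: p)%:F = scalar_frac c * p%:F.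
Proof. by rewrite -mul_mpolyC tofracM. Qed.

Definition semi_invariant g f c := frac_act g f = scalar_frac c * f.

Lemma semi_invariant_tofrac g p c : g \in unitmx -> poly_act g p = c *: p ->
  semi_invariant g p%:F c.
Proof.
by move=> gu e; rewrite /semi_invariant frac_act_tofrac // e tofracZ.
Qed.

Lemma semi_invariantM g f1 f2 c1 c2 : g \in unitmx -> semi_invariant g f1 c1 ->
  semi_invariant g f2 c2 ->
  semi_invariant g (f1 * f2) (c1 * c2).
Proof.
by rewrite /semi_invariant => gu s1 s2;
  rewrite frac_actM // s1 s2 rmorphM mulrACA.
Qed.

Lemma semi_invariantV g f c : g \in unitmx -> semi_invariant g f c ->
  semi_invariant g f^-1 c^-1.
Proof.
by rewrite /semi_invariant => gu s; rewrite frac_actV // s invfM fmorphV.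
Qed.

Lemma semi_invariant1 g : g \in unitmx -> semi_invariant g 1 1.
Proof.
move=> gu; rewrite /semi_invariant -tofrac1 frac_act_tofrac // poly_act1
  [scalar_frac 1]rmorph1.
by rewrite mul1r.
Qed.

Lemma semi_invariantXn g f c n : g \in unitmx -> semi_invariant g f c ->
  semi_invariant g (f ^+ n) (c ^+ n).
Proof.
move=> gu s; elim: n => [|n IH]; first by rewrite !expr0;
  exact: semi_invariant1.
by rewrite !exprS; exact: semi_invariantM.
Qed.

Lemma semi_invariantXz g f c (n : int) : g \in unitmx -> semi_invariant g f c ->
  semi_invariant g (f ^ n) (c ^ n).
Proof.
move=> gu s; case: n => n; first exact: semi_invariantXn.
by rewrite !NegzE -!invr_expz; apply: semi_invariantV => //;
  exact: semi_invariantXn.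
Qed.

Lemma semi_invariant_prod (I : finType) g (f : I -> _) (c : I -> C) :
  g \in unitmx ->
  (forall i, semi_invariant g (f i) (c i)) ->
    semi_invariant g (\prod_i f i) (\prod_i c i).
Proof.
move=> gu s; apply: (big_rec2 (semi_invariant g)); first exact: semi_invariant1.
by move=> i c' f' _ s'; apply: semi_invariantM.
Qed.

End Action.

(** * Traceless Hermitian matrices *)

Section PauliMatrices.
Local Open Scope sesquilinear_scope.
Variable R : realType.
Local Notation C := R[i].
Implicit Types (g h : 'M[C]_2) (v w : 'cV[C]_2) (x y : 'cV[R]_3)
  (A B : 'M[R]_3).

Lemma sum3E (V : nmodType) (F : 'I_3 -> V) : \sum_i F i = F 0 + F 1 + F 2.
Proof.
rewrite !big_ord_recl big_ord0 addr0 addrA.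
by congr (F _ + F _ + F _); apply/val_inj.
Qed.

Lemma I3P (a : 'I_3) : [\/ a = 0, a = 1 | a = 2].
Proof.
by case: a => [[|[|[|//]]] ?]; [constructor 1|constructor 2|constructor 3];
  apply/val_inj.
Qed.

Lemma eq_cV3 x y : x 0 0 = y 0 0 -> x 1 0 = y 1 0 -> x 2 0 = y 2 0 -> x = y.
Proof. by move=> e0 e1 e2; apply/colP => a; case: (I3P a) => ->. Qed.

Lemma eq_cV2 v w : v 0 0 = w 0 0 -> v 1 0 = w 1 0 -> v = w.
Proof. by move=> e0 e1; apply/colP => a; case: (I2P a) => ->. Qed.

Lemma eq_mx2 g h : g 0 0 = h 0 0 -> g 0 1 = h 0 1 -> g 1 0 = h 1 0 ->
  g 1 1 = h 1 1 -> g = h.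
Proof.
by move=> e0 e1 e2 e3; apply/matrixP => a b; case: (I2P a) => ->;
  case: (I2P b) => ->.
Qed.

Lemma adjE m n (M : 'M[C]_(m, n)) a b : (M ^t* ) a b = ((M b a)^*)%C.
Proof. by rewrite !mxE. Qed.

Lemma hermE x : [/\ herm x 0 0 = (x 2 0)%:C, herm x 0 1 = x 0 0 -i* x 1 0,
  herm x 1 0 = x 0 0 +i* x 1 0 & herm x 1 1 = (- x 2 0)%:C].
Proof. by rewrite !mxE. Qed.

Lemma hermD x y : herm (x + y) = herm x + herm y.
Proof.
have [a0 a1 a2 a3] := hermE x; have [b0 b1 b2 b3] := hermE y.
have [c0 c1 c2 c3] := hermE (x + y).
apply: eq_mx2; rewrite mxE ?(a0, a1, a2, a3, b0, b1, b2, b3, c0, c1, c2, c3)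
  !mxE.
- by apply/eqP; rewrite eq_complex /= addr0 !eqxx.
- by apply/eqP; rewrite eq_complex /= opprD !eqxx.
- by apply/eqP; rewrite eq_complex /= !eqxx.
- by apply/eqP; rewrite eq_complex /= addr0 opprD !eqxx.
Qed.

Lemma hermZ (c : R) x : herm (c *: x) = c%:C *: herm x.
Proof.
have [a0 a1 a2 a3] := hermE x; have [c0 c1 c2 c3] := hermE (c *: x).
apply: eq_mx2; rewrite [RHS]mxE ?(a0, a1, a2, a3, c0, c1, c2, c3) !mxE;
  apply/eqP; rewrite eq_complex /=; apply/andP; split; apply/eqP; ring.
Qed.

Lemma herm_inj x y : herm x = herm y -> x = y.
Proof.
have [a0 a1 a2 a3] := hermE x; have [b0 b1 b2 b3] := hermE y.
move=> e; apply: eq_cV3.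
- by have := congr1 (fun M : 'M_2 => M 1 0) e; rewrite a2 b2 => -[].
- by have := congr1 (fun M : 'M_2 => M 1 0) e; rewrite a2 b2 => -[].
- by have := congr1 (fun M : 'M_2 => M 0 0) e; rewrite a0 b0 => -[].
Qed.

Lemma herm_adj x : herm x ^t* = herm x.
Proof.
have [a0 a1 a2 a3] := hermE x.
apply: eq_mx2; rewrite adjE ?(a0, a1, a2, a3) /=;
  apply/eqP; rewrite eq_complex /=; apply/andP; split; apply/eqP; ring.
Qed.

Lemma herm_tr x : \tr (herm x) = 0.
Proof.
have [a0 a1 a2 a3] := hermE x.
rewrite /mxtrace sum2E a0 a3;
  apply/eqP; rewrite eq_complex /=; apply/andP; split; apply/eqP; ring.
Qed.

Lemma mul2E m n (M : 'M[C]_(m, 2)) (N : 'M[C]_(2, n)) a b :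
  (M *m N) a b = M a 0 * N 0 b + M a 1 * N 1 b.
Proof. by rewrite mxE sum2E. Qed.

Definition sqnorm3 x : R := x 0 0 ^+ 2 + x 1 0 ^+ 2 + x 2 0 ^+ 2.

Lemma on_sphereE x : on_sphere x <-> sqnorm3 x = 1.
Proof.
rewrite /on_sphere /sqnorm3; split=> [/matrixP /(_ 0 0)|e].
  by rewrite !mxE sum3E !mxE !expr2.
by apply/matrixP => a b; rewrite !ord1 !mxE sum3E !mxE -!expr2 e.
Qed.

(** The anticommutation relations of the Pauli matrices. *)
Lemma herm_sq x : herm x *m herm x = (sqnorm3 x)%:C%:M.
Proof.
have [a0 a1 a2 a3] := hermE x; rewrite /sqnorm3.
apply: eq_mx2; rewrite mul2E ?(a0, a1, a2, a3) mxE /=;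
  apply/eqP; rewrite eq_complex /=; apply/andP; split; apply/eqP; ring.
Qed.

Lemma sqnorm3_eq0 x : sqnorm3 x = 0 -> x = 0.
Proof.
rewrite /sqnorm3 => e; have := sqr_ge0 (x 0 0); have := sqr_ge0 (x 1 0).
have := sqr_ge0 (x 2 0) => h2 h1 h0.
by apply: eq_cV3; rewrite mxE; apply/eqP; rewrite -sqrf_eq0; apply/eqP; lra.
Qed.

Lemma herm_sum x : herm x = \sum_b (x b 0)%:C *: herm (delta_mx b 0).
Proof.
rewrite sum3E -!hermZ -!hermD; congr herm.
by apply: eq_cV3; rewrite !mxE /=; ring.
Qed.

(** The Pauli matrices are orthogonal of norm 2 for the trace form. *)
Definition pauli_coords (H : 'M[C]_2) : 'cV[R]_3 :=
  \col_a (complex.Re (\tr (herm (delta_mx a 0) *m H)) / 2).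

Lemma pauli_coordsK (H : 'M[C]_2) : H ^t* = H -> \tr H = 0 ->
  herm (pauli_coords H) = H.
Proof.
move=> hH; rewrite /mxtrace sum2E => tH.
have := adjE H 0 0; have := adjE H 0 1; rewrite hH.
have [c0 c1 c2 c3] := hermE (pauli_coords H).
have [p0 p1 p2 p3] := hermE (delta_mx 0 0).
have [q0 q1 q2 q3] := hermE (delta_mx 1 0).
have [r0 r1 r2 r3] := hermE (delta_mx 2 0).
have k a : pauli_coords H a 0 = complex.Re (\tr (herm (delta_mx a 0) *m H)) / 2
  by rewrite mxE.
move: (pauli_coords H) c0 c1 c2 c3 k => u c0 c1 c2 c3 k.
have := k 2; have := k 1; have := k 0.
rewrite /mxtrace !sum2E !mul2E ?(p0,p1,p2,p3,q0,q1,q2,q3,r0,r1,r2,r3) !mxE /=.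
move: tH; case E0: (H 0 0) => [a b]; case E1: (H 0 1) => [c d].
case E2: (H 1 0) => [a' b']; case E3: (H 1 1) => [c' d'] /=.
move=> [t1 t2] k0 k1 k2 [g1 g2] [g3].
apply: eq_mx2; rewrite ?(c0, c1, c2, c3, E0, E1, E2, E3) ?(k0, k1, k2);
  apply/eqP; rewrite eq_complex /=; apply/andP; split; apply/eqP; lra.
Qed.

End PauliMatrices.

(** * The homomorphism from SU(2) to SO(3) *)

Section DoubleCover.
Local Open Scope sesquilinear_scope.
Variable R : realType.
Local Notation C := R[i].
Implicit Types (g h : 'M[C]_2) (v w : 'cV[C]_2) (x y : 'cV[R]_3)
  (A B : 'M[R]_3).

Lemma ReD (a b : C) : complex.Re (a + b) = complex.Re a + complex.Re b.
Proof. by case: a => ? ?; case: b. Qed.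

Lemma ReZ (c : R) (b : C) : complex.Re (c%:C * b) = c * complex.Re b.
Proof. by case: b => a b /=; rewrite mul0r subr0. Qed.

Lemma conjcN (z : C) : ((- z)^*)%C = - (z^*)%C.
Proof. exact: raddfN. Qed.

Lemma adjM (g h : 'M[C]_2) : (g *m h) ^t* = h ^t* *m g ^t*.
Proof. by rewrite trmx_mul map_mxM. Qed.

Lemma adjK m n (M : 'M[C]_(m, n)) : M ^t* ^t* = M.
Proof. by apply/matrixP => a b; rewrite !adjE conjcK. Qed.

Lemma SU2_mul1 g : SU2 g -> g *m g ^t* = 1%:M.
Proof. by case=> /unitarymxP. Qed.

Lemma SU2_mul2 g : SU2 g -> g ^t* *m g = 1%:M.
Proof. by move/SU2_mul1/mulmx1C. Qed.

Lemma SU2_unit g : SU2 g -> g \in unitmx.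
Proof. by case=> /unitarymx_unit. Qed.

Lemma SU2_inv g : SU2 g -> invmx g = g ^t*.
Proof. by case=> /invmx_unitary. Qed.

Lemma SU2_entries g : SU2 g -> g 1 1 = ((g 0 0)^*)%C /\ g 1 0 = - ((g 0 1)^*)%C.
Proof.
move=> sg; have [h00 h01 h10 h11] := invmx2 (proj2 sg); move: h00 h01.
rewrite SU2_inv // !adjE => -> h01; split => //.
apply: (can_inj (@conjcK _)); rewrite h01.
by rewrite conjcN conjcK.
Qed.

Lemma SU2M g h : SU2 g -> SU2 h -> SU2 (g *m h).
Proof.
move=> sg sh; split; last by rewrite det_mulmx (proj2 sg) (proj2 sh) mulr1.
apply/unitarymxP; rewrite adjM mulmxA -(mulmxA g) SU2_mul1 // mulmx1.
exact: SU2_mul1.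
Qed.

Lemma SU2_adj g : SU2 g -> SU2 (g ^t*).
Proof.
move=> sg; split; first by rewrite trmxC_unitary; case: sg.
have := congr1 determinant (SU2_mul1 sg).
by rewrite det_mulmx (proj2 sg) det1 mul1r.
Qed.

Lemma SU2N g : SU2 g -> SU2 (- g).
Proof.
move=> [/unitarymxP ug dg]; split; last
  by rewrite -scaleN1r detZ sqrrN expr1n mul1r.
apply/unitarymxP; rewrite -ug; apply: eq_mx2; rewrite !mul2E !adjE !mxE;
  rewrite !conjcN /=; ring.
Qed.

Lemma SU2_1 : SU2 (1%:M : 'M[C]_2).
Proof.
by split; [apply/unitarymxP; rewrite trmx1 map_mx1 mulmx1 | rewrite det1].
Qed.

Lemma so3_ofab g a b : so3_of g a b =
  complex.Re (\tr (herm (delta_mx a 0) *m (g *m herm (delta_mx b 0) *m g ^t*)))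
    / 2.
Proof. by rewrite mxE. Qed.

Lemma Re_tr_conjZ (P M N Q : 'M[C]_2) (c : R) :
  complex.Re (\tr (P *m (M *m (c%:C *: N) *m Q))) =
  c * complex.Re (\tr (P *m (M *m N *m Q))).
Proof.
rewrite -(scalemxAr c%:C M N) -(scalemxAl c%:C (M *m N) Q).
by rewrite -(scalemxAr c%:C P) mxtraceZ ReZ.
Qed.

Lemma half_dot (s0 s1 s2 t0 t1 t2 : R) :
  s0 / 2 * t0 + s1 / 2 * t1 + s2 / 2 * t2 = (t0 * s0 + t1 * s1 + t2 * s2) / 2.
Proof. by field. Qed.

(** Conjugation by g preserves the traceless Hermitian matrices, and so3_of g is
    its matrix in the basis of Pauli matrices. *)
Lemma so3_ofE g x : SU2 g -> herm (so3_of g *m x) = g *m herm x *m g ^t*.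
Proof.
move=> sg; pose T a b : R :=
  complex.Re (\tr (herm (delta_mx a 0) *m
    (g *m herm (delta_mx b 0) *m g ^t* ))).
rewrite -[RHS]pauli_coordsK.
- congr herm; apply/colP => a; rewrite mxE [RHS]mxE sum3E !so3_ofab.
  have e : complex.Re (\tr (herm (delta_mx a 0) *m (g *m herm x *m g ^t* ))) =
    x 0 0 * T a 0 + x 1 0 * T a 1 + x 2 0 * T a 2.
    rewrite [herm x]herm_sum sum3E !mulmxDr !mulmxDl !mulmxDr !mxtraceD !ReD.
    by congr (_ + _ + _); exact: Re_tr_conjZ.
  apply: etrans (congr1 (fun z => z / 2) (esym e)).
  exact: half_dot.
- by rewrite !adjM adjK herm_adj mulmxA.
- by rewrite mxtrace_mulC mulmxA SU2_mul2 // mul1mx herm_tr.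
Qed.

Lemma eq_mx3 A B : (forall x, A *m x = B *m x) -> A = B.
Proof.
move=> e; apply/matrixP => a b; have /colP /(_ a) := e (delta_mx b 0).
by rewrite -!colE !mxE.
Qed.

Lemma so3_ofM g h : SU2 g -> SU2 h -> so3_of (g *m h) = so3_of g *m so3_of h.
Proof.
move=> sg sh; apply: eq_mx3 => x; apply: herm_inj.
rewrite so3_ofE; last exact: SU2M.
by rewrite -[so3_of g *m so3_of h *m x]mulmxA !so3_ofE // adjM !mulmxA.
Qed.

Lemma so3_of1 : so3_of (1%:M : 'M[C]_2) = 1%:M.
Proof.
apply: eq_mx3 => x; apply: herm_inj; rewrite so3_ofE; last exact: SU2_1.
by rewrite trmx1 map_mx1 !mul1mx mulmx1.
Qed.

Lemma adjN g : (- g) ^t* = - (g ^t* ).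
Proof. by apply/matrixP => a b; rewrite adjE [RHS]mxE adjE mxE conjcN. Qed.

Lemma so3_ofN g : so3_of (- g) = so3_of g.
Proof.
apply/matrixP => a b; rewrite so3_ofab [RHS]so3_ofab adjN.
have -> N : - g *m N *m - (g ^t* ) = g *m N *m g ^t*
  by rewrite mulmxN !mulNmx opprK.
by [].
Qed.

(** Cyclicity of the trace exchanges the two Pauli matrices in the coefficients
    of so3_of. *)
Lemma so3_of_adj g : so3_of (g ^t* ) = (so3_of g)^T.
Proof.
apply/matrixP => a b; rewrite [RHS]mxE so3_ofab [RHS]so3_ofab adjK.
have -> // (M N : 'M[C]_2) : \tr (M *m (g ^t* *m N *m g)) =
  \tr (N *m (g *m M *m g ^t* )).
by rewrite mxtrace_mulC -!mulmxA mxtrace_mulC !mulmxA.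
Qed.

Lemma so3_of_orth g : SU2 g -> (so3_of g)^T *m so3_of g = 1%:M.
Proof.
move=> sg; rewrite -so3_of_adj -so3_ofM //; last exact: SU2_adj.
by rewrite SU2_mul2 // so3_of1.
Qed.

Lemma parallel_of_cross0 v w : v != 0 -> v 0 0 * w 1 0 = v 1 0 * w 0 0 ->
  exists c, w = c *: v.
Proof.
move=> v0 e; have [v00|v00] := eqVneq (v 0 0) 0.
  have v10 : v 1 0 != 0.
    by apply: contra_neq v0 => v10; apply: eq_cV2; rewrite mxE.
  exists (w 1 0 / v 1 0); apply: eq_cV2; rewrite mxE; last by rewrite divfK.
  by move/eqP: e; rewrite v00 mul0r eq_sym mulf_eq0 (negPf v10) => /eqP ->;
    rewrite mulr0.
exists (w 0 0 / v 0 0); apply: eq_cV2; rewrite mxE; first by rewrite divfK.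
by rewrite mulrAC [w 0 0 * _]mulrC -e mulrAC divff // mul1r.
Qed.

(** herm x squares to the scalar |x|^2. *)
Lemma herm_ker x v : v != 0 -> herm x *m v = 0 -> x = 0.
Proof.
move=> v0 e; apply: sqnorm3_eq0; apply/eqP; move: v0; apply: contra_neqT => x0.
have := congr1 (mulmx (herm x)) e; rewrite mulmxA herm_sq mulmx0 mul_scalar_mx.
move=> /eqP; rewrite scaler_eq0 => /orP[/eqP[] h|/eqP //].
by rewrite h eqxx in x0.
Qed.

(** The points of the sphere have distinct lines: herm (x - y) kills a common
    vector. *)
Lemma line_inj x y v : v != 0 -> line_of x v -> line_of y v -> x = y.
Proof.
rewrite /line_of /= => v0 hx hy; apply/eqP; rewrite -subr_eq0; apply/eqP.
apply: (herm_ker v0); rewrite hermD mulmxDl -scaleN1r hermZ -scalemxAl hx hy.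
by rewrite [(-1)%:C]rmorphN1 scaleN1r subrr.
Qed.

End DoubleCover.

(** * Points of the sphere as lines of the complex plane *)

Section Lines.
Local Open Scope sesquilinear_scope.
Variable R : realType.
Local Notation C := R[i].
Implicit Types (g h : 'M[C]_2) (v w : 'cV[C]_2) (x y : 'cV[R]_3)
  (A B : 'M[R]_3).

(** herm x is an involution of trace 0, so herm x + 1 is nonzero and herm x
    fixes its columns. *)
Lemma line_exists x : on_sphere x -> exists2 v, v != 0 & line_of x v.
Proof.
move=> /on_sphereE hx; pose M := herm x + 1%:M.
have hM : herm x *m M = M.
  by rewrite /M mulmxDr herm_sq hx mulmx1 addrC.
have [b Mb] : exists b : 'I_2, col b M != 0.
  apply/existsP; apply: contraT; rewrite negb_exists => /forallP M0.
  have : \tr M = 0.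
    rewrite /mxtrace sum2E.
    by have /negPn/eqP/colP/(_ 0) := M0 0; have /negPn/eqP/colP/(_ 1) := M0 1;
      rewrite !mxE => -> ->; rewrite addr0.
  by rewrite /M mxtraceD herm_tr mxtrace1 add0r => /eqP; rewrite pnatr_eq0.
by exists (col b M) => //; rewrite /line_of /= !colE mulmxA hM.
Qed.

(** The eigenspace is a line: with z the third coordinate of x, the two rows of
    herm x show that D = det (v | w) satisfies z D = D and z D = - D. *)
Lemma line_cross x v w : line_of x v -> line_of x w ->
  v 0 0 * w 1 0 = v 1 0 * w 0 0.
Proof.
rewrite /line_of /= => /colP hv /colP hw.
have := hv 0; have := hv 1; have := hw 0; have := hw 1; rewrite !mul2E.
have [-> -> -> ->] := hermE x.
set z := (x 2 0)%:C; have -> : (- x 2 0)%:C = - z by exact: raddfN.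
move: (x 0 0 -i* _) (x 0 0 +i* _) => p q.
move: (v 0 0) (v 1 0) (w 0 0) (w 1 0) z => v0 v1 w0 w1 z e1 e2 e3 e4.
have h1 : z * (v0 * w1 - v1 * w0) = v0 * w1 - v1 * w0.
  by rewrite -{2}e4 -{2}e2; ring.
have h2 : z * (v0 * w1 - v1 * w0) = - (v0 * w1 - v1 * w0).
  by rewrite -{2}e1 -{2}e3; ring.
apply/eqP; rewrite -subr_eq0; apply/eqP.
have : (v0 * w1 - v1 * w0) *+ 2 = 0 by rewrite mulr2n -{1}h1 h2 addNr.
by move/eqP; rewrite mulrn_eq0 => /eqP.
Qed.

Lemma line_scale x c v : line_of x v -> line_of x (c *: v).
Proof. by rewrite /line_of /= => hv; rewrite -scalemxAr hv. Qed.

Lemma line_so3 g x v : SU2 g -> line_of x v -> line_of (so3_of g *m x) (g *m v).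
Proof.
rewrite /line_of /= => sg hv.
by rewrite so3_ofE // -!mulmxA (mulmxA (g ^t* )) SU2_mul2 // mul1mx hv.
Qed.

Lemma eigenline_of_fixed g x v : SU2 g -> v != 0 -> line_of x v ->
  so3_of g *m x = x ->
  exists z, g *m v = z *: v.
Proof.
move=> sg v0 hv gx; apply: parallel_of_cross0 => //; apply: (line_cross hv).
by have := line_so3 sg hv; rewrite gx.
Qed.

Lemma fixed_of_eigenline g x v z : SU2 g -> v != 0 -> line_of x v ->
  g *m v = z *: v ->
  so3_of g *m x = x.
Proof.
move=> sg v0 hv gv; have z0 := eigen_neq0 (proj2 sg) v0 gv.
apply: (@line_inj _ _ _ (z *: v)); first by rewrite scaler_eq0 negb_or z0.
  by rewrite -gv; exact: line_so3.
exact: line_scale.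
Qed.

Definition north_pole : 'cV[R]_3 := delta_mx 2 0.

(** The element of SU(2) with first column the unit vector (a, b). *)
Definition su2_mx (a b : C) : 'M[C]_2 :=
  \matrix_(i, j) if j == 0 then if i == 0 then a else b
                 else if i == 0 then - (b^*)%C else (a^*)%C.

Lemma det2E (K : comNzRingType) (g : 'M[K]_2) :
  \det g = g 0 0 * g 1 1 - g 0 1 * g 1 0.
Proof.
rewrite (expand_det_row _ 0) sum2E /cofactor !det_mx11 !mxE /=.
have -> : lift 0 0 = 1 :> 'I_2 by apply/val_inj.
have -> : lift 1 0 = 0 :> 'I_2 by apply/val_inj.
by rewrite addn0 expr0 expr1 mul1r mulN1r mulrN.
Qed.

Lemma SU2_su2_mx a b : a * (a^*)%C + b * (b^*)%C = 1 -> SU2 (su2_mx a b).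
Proof.
move=> e; split; last by rewrite det2E !mxE /= -e; ring.
apply/unitarymxP; apply: mulmx1C; apply: eq_mx2;
  rewrite mul2E !adjE !mxE /= ?conjcN ?conjcK ?eqxx /=.
- by rewrite -e; ring.
- by ring.
- by ring.
- by rewrite -e; ring.
Qed.

Lemma unit_line x : on_sphere x ->
  exists2 v, line_of x v & v 0 0 * ((v 0 0)^*)%C + v 1 0 * ((v 1 0)^*)%C = 1.
Proof.
move=> /line_exists [v v0 hv]; pose n :=
  v 0 0 * ((v 0 0)^*)%C + v 1 0 * ((v 1 0)^*)%C.
have n0 : 0 < n.
  rewrite lt_neqAle addr_ge0 ?mulcJ_ge0 // andbT eq_sym;
    apply: contra_neq v0 => /eqP.
  rewrite paddr_eq0 ?mulcJ_ge0 // !mulf_eq0 !conjc_eq0 !orbb =>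
    /andP[/eqP h0 /eqP h1].
  by apply: eq_cV2; rewrite mxE.
pose s := sqrtC n.
exists (s^-1 *: v); first exact: line_scale.
have sc : ((s^-1)^*)%C = s^-1.
  rewrite conjc_inv; congr (_^-1); apply: (geC0_conj _); rewrite sqrtC_ge0;
    exact: ltW.
have cM (a b : C) : ((a * b)^*)%C = (a^*)%C * (b^*)%C by exact: rmorphM.
rewrite !mxE !cM sc; transitivity (s ^- 2 * n);
  last by rewrite sqrtCK mulVf // gt_eqF.
by rewrite /n -exprVn; ring.
Qed.

(** The unitary matrix sending the first basis vector, which lies on the line of
    the north pole, to a unit vector of the line of x. *)
Lemma rotation_to_point x : on_sphere x ->
  exists2 g, SU2 g & so3_of g *m north_pole = x.
Proof.
move=> /unit_line [v hv nv]; exists (su2_mx (v 0 0) (v 1 0));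
  first exact: SU2_su2_mx.
have v0 : v != 0.
  by apply: contra_eq_neq nv => ->; rewrite !mxE !mul0r addr0 eq_sym oner_eq0.
have ve : su2_mx (v 0 0) (v 1 0) *m delta_mx 0 0 = v.
  by apply: eq_cV2; rewrite mul2E !mxE /= !mulr1 !mulr0 addr0.
have hz : line_of north_pole (delta_mx 0 0).
  have [h0 h1 h2 h3] := hermE north_pole.
  apply: eq_cV2; rewrite mul2E ?(h0, h1, h2, h3) !mxE /= mulr0 addr0 mulr1 //.
by apply: (line_inj v0) hv; have := line_so3 (SU2_su2_mx nv) hz; rewrite ve.
Qed.

End Lines.

(** * Axes of rotations and lifts to SU(2) *)

Section AxesAndLifts.
Local Open Scope sesquilinear_scope.
Variable R : realType.
Local Notation C := R[i].
Implicit Types (g h : 'M[C]_2) (v w : 'cV[C]_2) (x y : 'cV[R]_3)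
  (A B : 'M[R]_3).

Lemma mul3E m n (M : 'M[R]_(m, 3)) (N : 'M[R]_(3, n)) a b :
  (M *m N) a b = M a 0 * N 0 b + M a 1 * N 1 b + M a 2 * N 2 b.
Proof. by rewrite mxE sum3E. Qed.

Lemma det3E A : \det A = A 2 0 * (A 0 1 * A 1 2 - A 0 2 * A 1 1)
  - A 2 1 * (A 0 0 * A 1 2 - A 0 2 * A 1 0) + A 2 2 *
    (A 0 0 * A 1 1 - A 0 1 * A 1 0).
Proof.
rewrite (expand_det_row _ 2) sum3E /cofactor !det2E !mxE /=.
have -> : lift 2 0 = 0 :> 'I_3 by apply/val_inj.
have -> : lift 2 1 = 1 :> 'I_3 by apply/val_inj.
have -> : lift 0 0 = 1 :> 'I_3 by apply/val_inj.
have -> : lift 0 1 = 2 :> 'I_3 by apply/val_inj.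
have -> : lift 1 0 = 0 :> 'I_3 by apply/val_inj.
have -> : lift 1 1 = 2 :> 'I_3 by apply/val_inj.
ring.
Qed.

(** A and its transpose fix the north pole, so only a 2 x 2 block ((a, b), (c,
    d)) is left, and (a - d)^2 + (b + c)^2 is the sum of the squared norms of
    its columns minus twice its determinant, which is 0. *)
Lemma vertical_rotation A : A^T *m A = 1%:M -> \det A = 1 ->
  A *m north_pole R = north_pole R ->
  exists a c, a ^+ 2 + c ^+ 2 = 1 /\
   forall x, [/\ (A *m x) 0 0 = a * x 0 0 - c * x 1 0,
      (A *m x) 1 0 = c * x 0 0 + a * x 1 0 & (A *m x) 2 0 = x 2 0].
Proof.
move=> oA dA Az; have Atz : A^T *m north_pole R = north_pole R
  by rewrite -{1}Az mulmxA oA mul1mx.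
have ez0 : north_pole R 0 0 = 0 by rewrite mxE.
have ez1 : north_pole R 1 0 = 0 by rewrite mxE.
have ez2 : north_pole R 2 0 = 1 by rewrite mxE.
have c0 := congr1 (fun M : 'cV_3 => M 0 0) Az;
  have c1 := congr1 (fun M : 'cV_3 => M 1 0) Az.
have c2 := congr1 (fun M : 'cV_3 => M 2 0) Az.
have r0 := congr1 (fun M : 'cV_3 => M 0 0) Atz;
  have r1 := congr1 (fun M : 'cV_3 => M 1 0) Atz.
have o0 := congr1 (fun M : 'M_3 => M 0 0) oA;
  have o1 := congr1 (fun M : 'M_3 => M 1 1) oA.
move: c0 c1 c2 r0 r1 o0 o1; rewrite !mul3E ?(ez0, ez1, ez2) ![A^T _ _]mxE
  ![1%:M _ _]mxE /=.
rewrite !mulr0 !mulr1 !add0r => c0 c1 c2 r0 r1 o0 o1.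
move: dA; rewrite det3E c0 c1 c2 r0 r1 => dA.
rewrite r0 r1 !mul0r !addr0 in o0 o1.
have s : (A 0 0 - A 1 1) ^+ 2 + (A 0 1 + A 1 0) ^+ 2 = 0.
  transitivity ((A 0 0 * A 0 0 + A 1 0 * A 1 0) +
    (A 0 1 * A 0 1 + A 1 1 * A 1 1) - 2 * (A 0 0 * A 1 1 - A 0 1 * A 1 0));
      first by ring.
  by rewrite o0 o1; lra.
move/eqP: s; rewrite paddr_eq0 ?sqr_ge0 // !sqrf_eq0 => /andP[/eqP s1 /eqP s2].
have e1 : A 1 1 = A 0 0 by lra.
have e2 : A 0 1 = - A 1 0 by lra.
exists (A 0 0), (A 1 0); split; first by rewrite !expr2.
move=> x; rewrite !mul3E c0 c1 c2 r0 r1 e1 e2; split; ring.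
Qed.

(** The half angle: z is a square root of a - i c, an eigenvalue of the
    rotation, and diag (z, conj z) multiplies x_0 - i x_1 by z^2. *)
Lemma lift_vertical A : A^T *m A = 1%:M -> \det A = 1 ->
  A *m north_pole R = north_pole R ->
  exists2 g, SU2 g & so3_of g = A.
Proof.
move=> oA dA Az; have [a [c [ac hA]]] := vertical_rotation oA dA Az.
pose z := sqrtC (a -i* c : C).
have zz : z * (z^*)%C = 1.
  have h : (z * (z^*)%C) ^+ 2 = 1.
    have -> : (z * (z^*)%C) ^+ 2 = z ^+ 2 * ((z ^+ 2)^*)%C.
      by rewrite [((z ^+ 2)^*)%C]rmorphXn exprMn.
    rewrite /z sqrtCK /=; apply/eqP; rewrite eq_complex /=; apply/andP.
    by split; apply/eqP; rewrite -?ac; ring.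
  move/eqP: h; rewrite sqrf_eq1 => /orP[/eqP //|/eqP h].
  by have := mulcJ_ge0 z; rewrite h oppr_ge0 ler10.
have sz : SU2 (su2_mx z 0) by apply: SU2_su2_mx; rewrite mul0r addr0.
exists (su2_mx z 0) => //; apply: eq_mx3 => x; apply: herm_inj;
  rewrite so3_ofE //.
have [h0 h1 h2 h3] := hermE x; have [k0 k1 k2 k3] := hermE (A *m x).
have [x0 x1 x2] := hA x; rewrite x0 x1 x2 in k0 k1 k2 k3.
have z2 : z * z = a -i* c by rewrite -expr2 sqrtCK.
have zc2 : (z^*)%C * (z^*)%C = a +i* c.
  by rewrite -[LHS](rmorphM conjc) z2 /= opprK.
apply: eq_mx2; rewrite !mul2E !adjE ?(k0, k1, k2, k3, h0, h1, h2, h3) !mxE /=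
  ?oppr0 ?conjc0 ?conjcN ?conjc0 ?conjcK !(mul0r,mulr0,addr0,add0r,oppr0).
- by rewrite mulrAC zz mul1r.
- rewrite mulrAC z2; apply/eqP; rewrite eq_complex /=; apply/andP.
  by split; apply/eqP; ring.
- rewrite mulrAC zc2; apply/eqP; rewrite eq_complex /=; apply/andP.
  by split; apply/eqP; ring.
- by rewrite mulrAC [_ * z]mulrC zz mul1r.
Qed.

(** Conjugation by a rotation taking the north pole to x reduces the study of a
    rotation with a known axis to vertical_rotation. *)
Lemma conj_to_vertical A x : SO3 A -> on_sphere x -> A *m x = x ->
  exists g A', [/\ SU2 g, so3_of g *m north_pole R = x, A' *m north_pole R =
    north_pole R &
    [/\ A'^T *m A' = 1%:M, \det A' = 1,
      A = so3_of g *m A' *m (so3_of g)^T & A' = (so3_of g)^T *m A *m so3_of g]].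
Proof.
move=> [oA dA] sx Ax; have [g sg gx] := rotation_to_point sx.
have oB := so3_of_orth sg; have oB' := mulmx1C oB.
exists g, ((so3_of g)^T *m A *m so3_of g); split => //.
  by rewrite -mulmxA gx -mulmxA Ax -gx mulmxA oB mul1mx.
split => //.
- rewrite !trmx_mul trmxK !mulmxA -(mulmxA _ (so3_of g)) oB' mulmx1.
  by rewrite -(mulmxA _ A^T) oA mulmx1.
- rewrite !det_mulmx dA mulr1 -det_mulmx;
  exact: (etrans (congr1 _ oB) (det1 _ _)).
- by rewrite !mulmxA oB' mul1mx -mulmxA oB' mulmx1.
Qed.

Lemma so3_lift A x : SO3 A -> on_sphere x -> A *m x = x ->
  exists2 g, SU2 g & so3_of g = A.
Proof.
move=> sA sx Ax; have [g [A' [sg gx A'z [oA' dA' eA _]]]] :=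
  conj_to_vertical sA sx Ax.
have [h sh hA'] := lift_vertical oA' dA' A'z.
have sgh := SU2M sg sh; have sg' := SU2_adj sg.
exists (g *m h *m g ^t* ); first exact: (SU2M sgh sg').
by rewrite (so3_ofM sgh sg') (so3_ofM sg sh) so3_of_adj hA' -eA.
Qed.

Lemma rotation_fixed_points A x y : SO3 A -> A != 1%:M -> on_sphere x ->
  on_sphere y ->
  A *m x = x -> A *m y = y -> y = x \/ y = - x.
Proof.
move=> sA A1 sx sy Ax Ay; have [g [A' [sg gx A'z [oA' dA' eA eA']]]] :=
  conj_to_vertical sA sx Ax.
have oB' := mulmx1C (so3_of_orth sg).
have [a [c [ac hA]]] := vertical_rotation oA' dA' A'z.
pose y' := (so3_of g)^T *m y.
have yy' : y = so3_of g *m y' by rewrite mulmxA oB' mul1mx.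
have A'y : A' *m y' = y' by rewrite eA' -mulmxA -yy' -mulmxA Ay.
have [e0 e1 _] := hA y'; rewrite A'y in e0 e1.
(* The first two coordinates of y' solve a linear system of this determinant. *)
have q0 : ((a - 1) ^+ 2 + c ^+ 2) * y' 0 0 = 0.
  transitivity ((a - 1) * (a * y' 0 0 - c * y' 1 0 - y' 0 0) + c *
    (c * y' 0 0 + a * y' 1 0 - y' 1 0)); first by ring.
  by rewrite -e0 -e1; ring.
have q1 : ((a - 1) ^+ 2 + c ^+ 2) * y' 1 0 = 0.
  transitivity ((a - 1) * (c * y' 0 0 + a * y' 1 0 - y' 1 0) - c *
    (a * y' 0 0 - c * y' 1 0 - y' 0 0)); first by ring.
  by rewrite -e0 -e1; ring.
have n0 : (a - 1) ^+ 2 + c ^+ 2 != 0.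
  apply: contra_neq A1 => /eqP; rewrite paddr_eq0 ?sqr_ge0 // !sqrf_eq0
    subr_eq0.
  move=> /andP[/eqP a1 /eqP c0].
  have A'1 : A' = 1%:M.
    apply: eq_mx3 => u; have [u0 u1 u2] := hA u; rewrite mul1mx.
    by apply: eq_cV3; rewrite ?(u0, u1, u2) ?a1 ?c0; ring.
  by rewrite eA A'1 mulmx1 oB'.
move/eqP: q0; rewrite mulf_eq0 (negPf n0) => /eqP y0.
move/eqP: q1; rewrite mulf_eq0 (negPf n0) => /eqP y1.
have yz : y = y' 2 0 *: x.
  rewrite -gx scalemxAr; rewrite {1}yy'; congr (_ *m _).
  by apply: eq_cV3; rewrite ?y0 ?y1 !mxE /= ?mulr0 ?mulr1.
move: sy => /on_sphereE; rewrite yz; move: sx => /on_sphereE;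
  rewrite /sqnorm3 !mxE => sx.
have -> t : (t * x 0 0) ^+ 2 + (t * x 1 0) ^+ 2 + (t * x 2 0) ^+ 2 =
   t ^+ 2 * (x 0 0 ^+ 2 + x 1 0 ^+ 2 + x 2 0 ^+ 2) by ring.
rewrite sx mulr1 => /eqP; rewrite sqrf_eq1 => /orP[/eqP ->|/eqP ->].
  by left; rewrite scale1r.
by right; rewrite scaleN1r.
Qed.

(** In odd dimension det (A - 1) = - det (A - 1) when A is a rotation, since the
    transpose of A - 1 is A^T (1 - A). *)
Lemma rotation_axis A : SO3 A -> exists2 x, on_sphere x & A *m x = x.
Proof.
move=> [oA dA].
have : \det (A - 1%:M) = 0.
  have e : \det (A - 1%:M) = - \det (A - 1%:M).
    rewrite -[LHS]det_tr raddfB /= trmx1.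
    have -> : A^T - 1%:M = A^T *m (- (A - 1%:M)).
      by rewrite mulmxN mulmxBr oA mulmx1 opprB.
    rewrite det_mulmx det_tr dA mul1r -scaleN1r detZ.
    by rewrite -signr_odd /= expr1 mulN1r.
  have : \det (A - 1%:M) *+ 2 = 0 by rewrite mulr2n {1}e addNr.
  by move/eqP; rewrite mulrn_eq0 => /eqP.
move/eqP/det0P => [u u0 hu].
have Atu : A *m u^T = u^T.
  have h : u *m A = u by move/eqP: hu; rewrite mulmxBr mulmx1 subr_eq0 => /eqP.
  have : A^T *m u^T = u^T by rewrite -trmx_mul h.
  by move=> {1}<-; rewrite mulmxA (mulmx1C oA) mul1mx.
have n0 : 0 < sqnorm3 u^T.
  rewrite lt_neqAle !addr_ge0 ?sqr_ge0 // andbT eq_sym; apply: contra_neq u0.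
  by move/sqnorm3_eq0/(congr1 trmx); rewrite trmxK trmx0.
exists ((Num.sqrt (sqnorm3 u^T))^-1 *: u^T); last by rewrite -scalemxAr Atu.
apply/on_sphereE; rewrite [LHS](_ : _ =
  (Num.sqrt (sqnorm3 u^T))^-1 ^+ 2 * sqnorm3 u^T); last first.
  by rewrite /sqnorm3 [in LHS]mxE [X in _ + X ^+ 2 + _]mxE
    [X in _ + _ + X ^+ 2]mxE; ring.
by rewrite exprVn sqr_sqrtr ?ltW // mulVf // gt_eqF.
Qed.

End AxesAndLifts.

(** * The character of the stabiliser of a point *)

Section StabilizerCharacter.
Local Open Scope sesquilinear_scope.
Variable R : realType.
Local Notation C := R[i].
Implicit Types (g h : 'M[C]_2) (v w : 'cV[C]_2) (x y : 'cV[R]_3)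
  (A B : 'M[R]_3).

(** SU(2) commutes with the antilinear map (v_0, v_1) |-> (- conj v_1, conj
    v_0), which gives the second column of su2_mx; so g multiplies this column
    by conj z. *)
Lemma SU2_diag g v z : SU2 g -> g *m v = z *: v ->
  g *m su2_mx (v 0 0) (v 1 0) = su2_mx (v 0 0) (v 1 0) *m su2_mx z 0.
Proof.
move=> sg gv; have [e11 e10] := SU2_entries sg.
have k0 := congr1 (fun u : 'cV_2 => u 0 0) gv;
  have k1 := congr1 (fun u : 'cV_2 => u 1 0) gv.
move: k0 k1; rewrite !mul2E [(z *: v) 0 0]mxE [(z *: v) 1 0]mxE e11 e10 =>
  k0 k1.
have c0 := congr1 conjc k0; have c1 := congr1 conjc k1.
have cM (a b : C) : ((a * b)^*)%C = (a^*)%C * (b^*)%C by exact: rmorphM.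
have cD (a b : C) : ((a + b)^*)%C = (a^*)%C + (b^*)%C by exact: rmorphD.
rewrite !(cD, cM, conjcN, conjcK) in c0 c1.
apply: eq_mx2; rewrite !mul2E !mxE /= ?e11 ?e10 ?conjc0 ?oppr0 ?mulr0 ?addr0
  ?add0r.
- by rewrite k0 mulrC.
- rewrite -[RHS]opprK mulNr opprK [(v 1 0)^*%C * _]mulrC -c1; ring.
- by rewrite k1 mulrC.
- rewrite [RHS]mulrC -c0; ring.
Qed.

Lemma su2_mx_unit v : v != 0 -> su2_mx (v 0 0) (v 1 0) \in unitmx.
Proof.
move=> v0; rewrite unitmxE det2E !mxE /= unitfE; apply: contra_neq v0.
have -> : v 0 0 * ((v 0 0)^*)%C - - ((v 1 0)^*)%C * v 1 0 =
   v 0 0 * ((v 0 0)^*)%C + v 1 0 * ((v 1 0)^*)%C by ring.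
move/eqP; rewrite paddr_eq0 ?mulcJ_ge0 // !mulf_eq0 !conjc_eq0 !orbb =>
  /andP[/eqP h0 /eqP h1].
by apply: eq_cV2; rewrite mxE.
Qed.

Lemma SU2_eigen_inj g h v z : SU2 g -> SU2 h -> v != 0 -> g *m v = z *: v ->
  h *m v = z *: v -> g = h.
Proof.
move=> sg sh v0 gv hv; rewrite -[g](mulmxK (su2_mx_unit v0)) (SU2_diag sg gv).
by rewrite -(SU2_diag sh hv) mulmxK // su2_mx_unit.
Qed.

(** With an eigenline fixed, an element of SU(2) is determined by its
    eigenvalue, and - g has the same rotation as g. *)
Lemma so3_of_eigen_inj g h v z t : SU2 g -> SU2 h -> v != 0 ->
  g *m v = z *: v ->
  h *m v = t *: v -> z ^+ 2 = t ^+ 2 -> so3_of g = so3_of h.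
Proof.
move=> sg sh v0 gv hv /eqP; rewrite eqf_sqr => /orP[/eqP e|/eqP e].
  by congr so3_of; apply: (SU2_eigen_inj sg sh v0 gv); rewrite e.
rewrite -(so3_ofN h); congr so3_of; apply: (SU2_eigen_inj sg (SU2N sh) v0 gv).
by rewrite mulNmx hv e scaleNr.
Qed.

(** Every line is an eigenline of g; that of the north pole makes g diagonal,
    and that of the point (1, 0, 0), spanned by (1, 1), makes it scalar. *)
Lemma so3_kernel g : SU2 g -> so3_of g = 1%:M ->
  exists a, a ^+ 2 = 1 /\ g = a%:M.
Proof.
move=> sg g1; pose x : 'cV[R]_3 := delta_mx 0 0.
have fx (y : 'cV[R]_3) : so3_of g *m y = y by rewrite g1 mul1mx.
have lz : line_of (north_pole R) (delta_mx 0 0).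
  have [h0 h1 h2 h3] := hermE (north_pole R).
  by apply: eq_cV2; rewrite mul2E ?(h0, h1, h2, h3) !mxE /= mulr0 addr0 mulr1.
have lx : line_of x (const_mx 1).
  have [h0 h1 h2 h3] := hermE x.
  apply: eq_cV2; rewrite mul2E ?(h0, h1, h2, h3) !mxE /= !mulr1;
   apply/eqP; rewrite eq_complex /=; apply/andP; split; apply/eqP; ring.
have e0 : (delta_mx 0 0 : 'cV[C]_2) != 0.
  by apply/eqP => /colP /(_ 0); rewrite !mxE /= => /eqP; rewrite oner_eq0.
have e1 : (const_mx 1 : 'cV[C]_2) != 0.
  by apply/eqP => /colP /(_ 0); rewrite !mxE /= => /eqP; rewrite oner_eq0.
have [a ga] := eigenline_of_fixed sg e0 lz (fx _).
have [b gb] := eigenline_of_fixed sg e1 lx (fx _).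
have [g11 g10] := SU2_entries sg.
have a0 := congr1 (fun u : 'cV_2 => u 0 0) ga;
  have a1 := congr1 (fun u : 'cV_2 => u 1 0) ga.
have b0 := congr1 (fun u : 'cV_2 => u 0 0) gb;
  have b1 := congr1 (fun u : 'cV_2 => u 1 0) gb.
move: a0 a1 b0 b1; rewrite !mul2E !mxE /= !(mulr0, mulr1, addr0, add0r) =>
  a0 a1 b0 b1.
rewrite a1 in g10; have g01 : g 0 1 = 0.
  by move/esym/eqP: g10; rewrite oppr_eq0 conjc_eq0 => /eqP.
rewrite a0 g01 addr0 in b0; rewrite a1 add0r in b1.
exists a; split; last by apply: eq_mx2; rewrite ?a0 ?g01 ?a1 ?b1 -?b0 !mxE.
by have := proj2 sg; rewrite det2E a0 g01 mul0r subr0 b1 -b0 expr2.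
Qed.

(** Two lifts of a rotation differ by a sign, so the square of the eigenvalue
    depends only on the rotation. *)
Lemma eigen_sqr_so3 g h v z t : SU2 g -> SU2 h -> v != 0 -> g *m v = z *: v ->
  h *m v = t *: v -> so3_of g = so3_of h -> z ^+ 2 = t ^+ 2.
Proof.
move=> sg sh v0 gv hv e; have sh' := SU2_adj sh.
have [a [a2 ea]] : exists a, a ^+ 2 = 1 /\ h ^t* *m g = a%:M.
  apply: so3_kernel; first exact: (SU2M sh' sg).
  apply: (etrans (so3_ofM sh' sg)); rewrite e.
  apply: (etrans (esym (so3_ofM sh' sh))); rewrite (SU2_mul2 sh);
    exact: so3_of1.
have gh : g = a *: h.
  have := congr1 (mulmx h) ea; rewrite mulmxA (SU2_mul1 sh) mul1mx => ->.
  by rewrite mul_mx_scalar.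
have : (z - a * t) *: v = 0.
  by rewrite scalerBl -gv -scalerA -hv gh -scalemxAl subrr.
move/eqP; rewrite scaler_eq0 (negPf v0) orbF subr_eq0 => /eqP ->.
by rewrite exprMn a2 mul1r.
Qed.

Section Stab.
Variables (Gamma : {fset 'M[R]_3}) (x : 'cV[R]_3) (v : 'cV[C]_2).
Hypotheses (pG : polyhedral Gamma) (sx : on_sphere x) (v0 : v != 0)
  (xv : line_of x v).

Let weight A (c : C) := exists g z, [/\ SU2 g, so3_of g = A, g *m v = z *: v
  & c = z ^+ 2].

Lemma in_stab A : (A \in stab Gamma x) = (A \in Gamma) && (A *m x == x).
Proof. by rewrite !inE. Qed.

Lemma stab_weight_exists A : A \in stab Gamma x -> exists c, weight A c.
Proof.
rewrite in_stab => /andP[AG /eqP Ax]; case: pG => sG _ _ _.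
have [g sg gA] := so3_lift (sG _ AG) sx Ax.
have [z gz] : exists z, g *m v = z *: v by apply: (eigenline_of_fixed sg v0 xv);
  rewrite gA.
by exists (z ^+ 2), g, z.
Qed.

(** The rotations fixing x are characterised by the squared eigenvalue at v of
    their lifts; it is multiplicative because v is a common eigenvector. *)
Lemma stab_character : exists om : 'M[R]_3 -> C,
  [/\ {in stab Gamma x, forall A, weight A (om A)},
    {in stab Gamma x &, injective om}
    & {in stab Gamma x &, forall A B, om (A *m B) = om A * om B}].
Proof.
have [om hom] : {om : 'M[R]_3 -> C & forall A, A \in stab Gamma x ->
  weight A (om A)}.
  apply: (@boolp.choice _ _ (fun A c => A \in stab Gamma x -> weight A c)) => A.
  have [As|] := boolP (A \in stab Gamma x); last by exists 0.
  by have [c hc] := stab_weight_exists As; exists c.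
exists om; split => // A B As Bs.
  have [g [z [sg <- gv ->]]] := hom A As;
    have [h [t [sh <- hv ->]]] := hom B Bs.
  exact: (so3_of_eigen_inj sg sh v0 gv hv).
have ABs : A *m B \in stab Gamma x.
  move: As Bs; rewrite !in_stab => /andP[AG /eqP Ax] /andP[BG /eqP Bx].
  by case: pG => _ _ mG _; rewrite mG // -mulmxA Bx Ax eqxx.
have [k [s [sk eAB kv ->]]] := hom _ ABs.
have [g [z [sg eA gv ->]]] := hom A As; have [h [t [sh eB hv ->]]] := hom B Bs.
rewrite -exprMn; apply: (eigen_sqr_so3 sk (SU2M sg sh) v0 kv).
  by rewrite -mulmxA hv -scalemxAr gv scalerA mulrC.
by rewrite (so3_ofM sg sh) eA eB.
Qed.

(** The set W of values of the character has as many elements as the stabiliser,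
    say nu, and is stable under multiplication by any w in W. Comparing the
    products of the elements of W and of w W gives w^nu = 1. If the N-th power
    kills W, so does the power d = gcd (nu, N); as there are at most d roots of
    unity of order dividing d, nu <= d, hence nu divides N. *)
Lemma stab_roots :
  (forall g z, binary Gamma g -> g *m v = z *: v ->
    (z ^+ 2) ^+ #|` stab Gamma x| = 1) /\
  (forall N : int, (forall g z, binary Gamma g -> g *m v = z *: v ->
    ((z ^+ 2) ^ N)%R = 1) ->
    (#|` stab Gamma x|%:Z %| N)%Z).
Proof.
have [om [hom iom mom]] := stab_character.
pose W := [seq om A | A <- stab Gamma x].
have uW : uniq W by rewrite map_inj_in_uniq ?fset_uniq.
have sW : size W = #|` stab Gamma x| by rewrite size_map.
have om0 A : A \in stab Gamma x -> om A != 0.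
  move=> /hom [g [z [sg _ gv ->]]]; rewrite expf_neq0 //.
  exact: (eigen_neq0 (proj2 sg) v0 gv).
have rW A : A \in stab Gamma x -> om A ^+ #|` stab Gamma x| = 1.
  move=> As; have pW : perm_eq [seq om A * c | c <- W] W.
    apply: uniq_perm => //; first by rewrite map_inj_uniq //; apply: mulfI;
      exact: om0.
    apply: (uniq_min_size _ _ _).2; rewrite ?size_map //.
      by rewrite map_inj_uniq //; apply: mulfI; exact: om0.
    move=> _ /mapP[_ /mapP[B Bs ->] ->]; rewrite -mom //; apply: map_f.
    move: As Bs; rewrite !in_stab => /andP[AG /eqP Ax] /andP[BG /eqP Bx].
    by case: pG => _ _ mG _; rewrite mG // -mulmxA Bx Ax eqxx.
  have nzW : \prod_(c <- W) c != 0.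
    by rewrite prodf_seq_neq0; apply/allP => _ /mapP[B Bs ->]; exact: om0.
  have : \prod_(c <- [seq om A * c | c <- W]) c = \prod_(c <- W) c
    by apply: perm_big.
  rewrite big_map big_split /= big_const_seq count_predT iter_mulr_1 sW.
  by move=> /(canRL (mulfK nzW)); rewrite divff.
split.
  move=> g z [sg gG] gv.
  have gs : so3_of g \in stab Gamma x.
    by rewrite in_stab gG (fixed_of_eigenline sg v0 xv gv) eqxx.
  have [h [t [sh eh hv e]]] := hom _ gs.
  by rewrite (eigen_sqr_so3 sg sh v0 gv hv (esym eh)) -e; exact: rW.
move=> N hN; set nu := #|` _| in rW sW *.
have nu0 : (0 < nu)%N.
  rewrite cardfs_gt0; apply/fset0Pn; exists 1%:M; rewrite in_stab mul1mx eqxx.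
  by case: pG => _ ->.
have wN A : A \in stab Gamma x -> om A ^+ `|N|%N = 1.
  move=> As; have AG : A \in Gamma by move: As; rewrite in_stab => /andP[].
  have [g [z [sg gA gv e]]] := hom A As.
  have : (om A ^ N)%R = 1 by rewrite e; apply: hN gv; rewrite /binary /= gA.
  case: (N) => n; first by rewrite -exprnP.
  by rewrite NegzE -invr_expz => /eqP; rewrite invr_eq1 => /eqP.
case: (egcdnP `|N|%N nu0) => km kn e _; set d := gcdn nu `|N| in e.
have d0 : (0 < d)%N by rewrite gcdn_gt0 nu0.
have wd A : A \in stab Gamma x -> om A ^+ d = 1.
  move=> As; have : om A ^+ (km * nu) = 1 by rewrite mulnC exprM rW // expr1n.
  by rewrite e exprD mulnC exprM wN // expr1n mul1r.
have : (nu <= d)%N.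
  rewrite -sW; apply: max_unity_roots => //.
  by apply/allP => _ /mapP[A As ->]; apply/unity_rootP; exact: wd.
move=> nud; have dnu : d = nu by apply/eqP;
  rewrite eqn_leq nud dvdn_leq // dvdn_gcdl.
by rewrite dvdzE /= -dnu dvdn_gcdr.
Qed.

End Stab.
End StabilizerCharacter.

(** * Orbits and the class equation *)

Section Counting.
Local Open Scope fset_scope.
Local Open Scope ring_scope.
Variable R : realType.
Variables (Gamma : {fset 'M[R]_3}) (Omega : finType)
  (S : Omega -> {fset 'cV[R]_3}).
Variable nu : Omega -> nat.
Hypothesis pG : polyhedral Gamma.
Hypothesis eS : exceptional_orbits Gamma S.
Hypothesis hnu : forall i x, x \in S i -> #|` stab Gamma x| = nu i.
Implicit Types (x y : 'cV[R]_3) (A B : 'M[R]_3).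

Lemma Gamma_SO3 A : A \in Gamma -> SO3 A.
Proof. by case: pG => h _ _ _ /h. Qed.

Lemma one_in_Gamma : 1%:M \in Gamma. Proof. by case: pG. Qed.

Lemma mul_in_Gamma A B : A \in Gamma -> B \in Gamma -> A *m B \in Gamma.
Proof. by case: pG => _ _ h _; exact: h. Qed.

Lemma inv_in_Gamma A : A \in Gamma -> invmx A \in Gamma.
Proof. by case: pG => _ _ _; apply. Qed.

Lemma Gamma_unit A : A \in Gamma -> A \in unitmx.
Proof. by move=> /Gamma_SO3 [_ dA]; rewrite unitmxE dA unitr1. Qed.

Lemma orbitP x y : reflect (exists2 A, A \in Gamma & y = A *m x)
  (y \in orbit_of Gamma x).
Proof. exact: imfsetP. Qed.

Lemma orbit_eq x y : y \in orbit_of Gamma x ->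
  orbit_of Gamma y = orbit_of Gamma x.
Proof.
move=> /orbitP [A AG ->]; apply/fsetP => z; apply/orbitP/orbitP => -[B BG ->].
  by exists (B *m A); [exact: mul_in_Gamma | rewrite mulmxA].
exists (B *m invmx A); first by apply: mul_in_Gamma => //; exact: inv_in_Gamma.
by rewrite mulmxA -(mulmxA B) mulVmx ?Gamma_unit // mulmx1.
Qed.

Lemma orbit_self x : x \in orbit_of Gamma x.
Proof. by apply/orbitP; exists 1%:M; rewrite ?one_in_Gamma ?mul1mx. Qed.

Lemma on_sphereM A x : SO3 A -> on_sphere x -> on_sphere (A *m x).
Proof.
move=> [oA _]; rewrite /on_sphere trmx_mul mulmxA -(mulmxA _ A^T) oA mulmx1.
by [].
Qed.

Lemma S_orbit i x : x \in S i -> S i = orbit_of Gamma x.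
Proof.
case: eS => _ /(_ i) [x0 [_ _ ->]] _ xS.
by rewrite (orbit_eq xS).
Qed.

Lemma S_sphere i x : x \in S i -> on_sphere x.
Proof.
case: eS => _ /(_ i) [x0 [s0 _ ->]] _ /orbitP [A AG ->].
by apply: on_sphereM => //; exact: Gamma_SO3.
Qed.

Lemma S_nonempty i : exists x, x \in S i.
Proof. by case: eS => _ /(_ i) [x [_ _ ->]] _; exists x; exact: orbit_self. Qed.

Lemma nu_gt1 i : (1 < nu i)%N.
Proof.
case: eS => _ /(_ i) [x [_ h e]] _.
by rewrite -(@hnu i x) // e orbit_self.
Qed.

Lemma S_act i A x : A \in Gamma -> x \in S i -> A *m x \in S i.
Proof. by move=> AG xS; rewrite (S_orbit xS); apply/orbitP; exists A. Qed.

Lemma S_inj i k x : x \in S i -> x \in S k -> i = k.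
Proof.
by move=> xi xk; case: eS => inj _ _; apply: inj;
  rewrite (S_orbit xi) (S_orbit xk).
Qed.

Lemma S_cover x : on_sphere x -> (1 < #|` stab Gamma x|)%N ->
  exists i, x \in S i.
Proof.
by move=> sx hx; case: eS => _ _ /(_ x sx hx) [i e]; exists i;
  rewrite e orbit_self.
Qed.

Lemma S_cover_fix x A : on_sphere x -> A \in Gamma -> A != 1%:M -> A *m x = x ->
  exists i, x \in S i.
Proof.
move=> sx AG A1 Ax; apply: S_cover => //.
have h : [fset A; 1%:M] `<=` stab Gamma x.
  by apply/fsubsetP => B; rewrite !inE => /orP[] /eqP ->;
    rewrite ?AG ?Ax ?one_in_Gamma ?mul1mx eqxx.
by rewrite (leq_trans _ (fsubset_leq_card h)) // cardfs2 A1.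
Qed.

Lemma fset_count (T : choiceType) (A : {fset T}) (p : pred T) :
  #|` [fset x in A | p x]| = (\sum_(x <- A) p x)%N.
Proof.
by rewrite card_fset_sum1 big_fset /= big_mkcond; apply: eq_bigr => x _;
  case: (p x).
Qed.

(** The elements taking x to y form a coset of the stabiliser. *)
Lemma transporter_card x y : y \in orbit_of Gamma x ->
  #|` [fset A in Gamma | A *m x == y]| = #|` stab Gamma x|.
Proof.
move=> /orbitP [B BG ->].
have -> : [fset A in Gamma | A *m x == B *m x] =
  [fset B *m A | A in stab Gamma x].
  apply/fsetP => A; rewrite !inE; apply/andP/imfsetP => /=.
    move=> [AG /eqP AB]; exists (invmx B *m A).
      by rewrite !inE mul_in_Gamma ?inv_in_Gamma //= -mulmxA AB mulKmx ?eqxx //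
        Gamma_unit.
    by rewrite mulKVmx // Gamma_unit.
  move=> [C]; rewrite !inE => /andP[CG /eqP Cx] ->.
  by rewrite mul_in_Gamma // -mulmxA Cx.
rewrite card_imfset //= => C D; exact: (can_inj (mulKmx (Gamma_unit BG))).
Qed.

(** Counts in two ways the pairs (A, y) with A x = y. *)
Lemma orbit_stabilizer i : (#|` S i| * nu i = #|` Gamma|)%N.
Proof.
have [x xS] := S_nonempty i.
transitivity (\sum_(y <- S i) \sum_(A <- Gamma) (A *m x == y))%N.
  rewrite (eq_big_seq (fun=> nu i)).
    by rewrite big_const_seq count_predT iter_addn_0 mulnC.
  move=> y yS /=; rewrite -fset_count transporter_card;
    last by rewrite -(S_orbit xS).
  exact: hnu xS.
rewrite exchange_big /= card_fset_sum1; apply: eq_big_seq => A AG /=.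
rewrite -fset_count (_ : [fset _ in _ | _] = [fset A *m x]) ?cardfs1 //.
apply/fsetP => y; rewrite !inE eq_sym andbC; case: eqP => // ->.
exact: S_act.
Qed.

(** Counts in two ways the pairs (A, x) with A <> 1 and A x = x: the fixed
    points of A are two antipodal points, each lying in exactly one exceptional
    orbit. *)
Lemma riemann_hurwitz : (\sum_i #|` S i| * (nu i).-1 = 2 * (#|` Gamma|).-1)%N.
Proof.
pose G' := Gamma `\ 1%:M.
transitivity (\sum_i \sum_(x <- S i) \sum_(A <- G') (A *m x == x))%N.
  apply: eq_bigr => i _; rewrite (eq_big_seq (fun=> (nu i).-1)).
    by rewrite big_const_seq count_predT iter_addn_0 mulnC.
  move=> x xS /=; rewrite -fset_count -(hnu xS).
  rewrite [in RHS](cardfsD1 1%:M) !inE one_in_Gamma mul1mx eqxx /=.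
  by congr #|` _|; apply/fsetP => A; rewrite !inE andbA.
under eq_bigr do rewrite exchange_big.
rewrite exchange_big /= (eq_big_seq (fun=> 2)).
  rewrite big_const_seq count_predT iter_addn_0; congr (2 * _)%N.
  by rewrite [in RHS](cardfsD1 1%:M) one_in_Gamma.
move=> A; rewrite !inE => /andP[A1 AG]; have sA := Gamma_SO3 AG.
have [x sx Ax] := rotation_axis sA.
have sx' : on_sphere (- x)
  by move/on_sphereE: sx => sx; apply/on_sphereE;
    rewrite -sx /sqnorm3 !mxE !sqrrN.
have Ax' : A *m (- x) = - x by rewrite mulmxN Ax.
have [i0 xi0] := S_cover_fix sx AG A1 Ax.
have [i1 xi1] := S_cover_fix sx' AG A1 Ax'.
have xx' : x != - x.
  apply/eqP => e; have : x *+ 2 = 0 by rewrite mulr2n {2}e subrr.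
  rewrite -scaler_nat => /eqP; rewrite scaler_eq0 pnatr_eq0 /= => /eqP x0.
  by move: sx => /on_sphereE; rewrite x0 /sqnorm3 !mxE expr0n /= !addr0 =>
    /esym/eqP; rewrite oner_eq0.
transitivity (\sum_i ((x \in S i) + ((- x) \in S i)))%N.
  apply: eq_bigr => i _; rewrite -fset_count.
  have -> : [fset y in S i | A *m y == y] =
    [fset y in [fset x; - x] | y \in S i].
    apply/fsetP => y; rewrite !inE andbC; case yS: (y \in S i);
      rewrite ?andbF ?andbT //.
    apply/eqP/orP => [Ay|[]/eqP -> //].
    by case: (rotation_fixed_points sA A1 sx (S_sphere yS) Ax Ay) => ->;
      rewrite eqxx; [left|right].
  by rewrite fset_count big_fsetU1 ?inE //= big_seq_fset1.
rewrite big_split /= (bigD1 i0) //= xi0 big1 ?addn0 => [|i ni].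
  rewrite (bigD1 i1) //= xi1 big1 ?addn0 // => i ni.
  by case h: (_ \in _) => //; rewrite (S_inj h xi1) eqxx in ni.
by case h: (_ \in _) => //; rewrite (S_inj h xi0) eqxx in ni.
Qed.

End Counting.

(** Modulo N, (m mod nu_i) d_i is m d_i since d_i nu_i = N, and the hypothesis
    on the d_i (nu_i - 1) gives sum_i d_i = 2. *)
Lemma residue_degree (Omega : finType) (d nu : Omega -> nat) (N : nat)
  (m : int) :
  (0 < N)%N -> (forall i, (d i * nu i)%N = N) -> (forall i, (0 < nu i)%N) ->
  (\sum_i d i * (nu i).-1 = 2 * N.-1)%N ->
  (N%:Z %| 2 * m - \sum_i (m %% (nu i)%:Z)%Z * (d i)%:Z)%Z.
Proof.
move=> N0 dN nu0 rh.
have rhZ : \sum_i ((d i)%:Z : int) = (#|Omega|%:Z - 2) * N%:Z + 2.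
  have : \sum_i (N%:Z - (d i)%:Z) = 2 * (N%:Z - 1).
    transitivity ((2 * N.-1)%N%:Z); last by rewrite PoszM -subn1 -subzn.
    rewrite -rh (big_morph Posz PoszD (erefl _)); apply: eq_bigr => i _.
    by rewrite -(dN i) -subn1 mulnBr muln1 -subzn // leq_pmulr.
  rewrite sumrB sumr_const => h.
  have : (N%:Z *+ #|xpredT : pred Omega|) = #|Omega|%:Z * N%:Z.
    by rewrite -mulr_natl natz.
  move=> h2; rewrite h2 in h.
  by rewrite -[LHS](subKr (#|Omega|%:Z * N%:Z)) h; ring.
apply/dvdzP; exists (2 * m - m * #|Omega|%:Z + \sum_i (m %/ (nu i)%:Z)%Z).
have -> : \sum_i (m %% (nu i)%:Z)%Z * (d i)%:Z =
    m * \sum_i ((d i)%:Z : int) - (\sum_i (m %/ (nu i)%:Z)%Z) * N%:Z.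
  rewrite mulr_sumr mulr_suml -sumrB; apply: eq_bigr => i _.
  rewrite {2}(divz_eq m (nu i)) -(dN i) PoszM; ring.
rewrite rhZ; ring.
Qed.

(** * Ground forms *)

Section GroundForms.
Local Open Scope fset_scope.
Local Open Scope ring_scope.
Variable R : realType.
Local Notation C := R[i].
Variables (Gamma : {fset 'M[R]_3}) (Omega : finType)
  (S : Omega -> {fset 'cV[R]_3}).
Variable P : Omega -> {mpoly C[2]}.
Hypothesis pG : polyhedral Gamma.
Hypothesis eS : exceptional_orbits Gamma S.
Hypothesis hP : forall i, ground_form (S i) (P i).
Variable V : 'cV[R]_3 -> 'cV[C]_2.
Hypothesis hV : forall x, on_sphere x -> V x != 0 /\ line_of x (V x).
Implicit Types (x y : 'cV[R]_3) (p q : {mpoly C[2]}).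

Let V0 i x : x \in S i -> V x != 0.
Proof. by move=> xS; case: (hV (S_sphere pG eS xS)). Qed.

Lemma line_form_other_line x y : on_sphere x -> on_sphere y -> x != y ->
  (line_form (V x)).@[(V y)^~ 0] != 0.
Proof.
move=> sx sy; apply: contra_neq; rewrite line_formE => /eqP;
  rewrite subr_eq0 => /eqP e.
have [x0 lx] := hV sx; have [y0 ly] := hV sy.
have [c e'] := parallel_of_cross0 x0 e.
by apply: (line_inj y0) ly; rewrite e'; exact: line_scale.
Qed.

Lemma line_form_prod_homog (s : seq 'cV[R]_3) :
  \prod_(x <- s) line_form (V x) \is (size s).-homog.
Proof.
elim: s => [|x s IH]; first by rewrite big_nil dhomog1.
by rewrite big_cons; apply: (dhomogM (line_form_homog _) IH).
Qed.

(** The product of the linear forms of the points of S_i divides p and has the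
    same degree. *)
Lemma vanishing_form i p : p \is #|` S i|.-homog ->
  (forall x, x \in S i -> p.@[(V x)^~ 0] = 0) ->
  exists c, p = c *: \prod_(x <- S i) line_form (V x).
Proof.
move=> hp p0.
have Vn : {in S i, forall x, V x != 0} by move=> x xS; exact: V0 xS.
have Vl : {in S i &, forall x y, x != y -> (line_form (V x)).@[(V y)^~ 0] != 0}.
  move=> x y xS yS; apply: line_form_other_line;
    [exact: (S_sphere pG eS xS)|exact: (S_sphere pG eS yS)].
have pl : {in S i, forall x, exists q, p = line_form (V x) ^+ 1 * q}.
  move=> x xS; have [q pq _] := line_form_factor (V0 xS) hp (p0 x xS).
  by exists q; rewrite expr1.
have [q] := line_form_prod_dvd (m := fun=> 1%N) (fset_uniq _) Vn Vl hp pl.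
move=> pq; rewrite big_const_seq count_predT iter_addn_0 mul1n subnn =>
  /homog0_const [c qc].
exists c; rewrite pq qc -mul_mpolyC mulrC; congr (_ * _).
Qed.

Lemma ground_neq0 i : P i != 0. Proof. by case: (hP i). Qed.
Lemma ground_homog i : P i \is #|` S i|.-homog. Proof. by case: (hP i). Qed.

Lemma ground_factor i : exists2 c, c != 0 & P i =
  c *: \prod_(x <- S i) line_form (V x).
Proof.
have [|c e] := vanishing_form (ground_homog i).
  by move=> x xS; case: (hP i) => _ _ /(_ x _ xS); apply;
    case: (hV (S_sphere pG eS xS)).
by exists c => //; apply: contra_neq (ground_neq0 i) => c0;
  rewrite e c0 scale0r.
Qed.

(** A ground form vanishes to order 1 on its orbit and does not vanish
    elsewhere. *)
Lemma ground_order i y : on_sphere y -> exists q,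
  [/\ P i = line_form (V y) ^+ (y \in S i) * q,
    q \is (#|` S i| - (y \in S i)).-homog
    & q.@[(V y)^~ 0] != 0].
Proof.
move=> sy; have [c c0 e] := ground_factor i.
have nz (s : seq 'cV[R]_3) : {subset s <= S i} -> y \notin s ->
    (c *: \prod_(x <- s) line_form (V x)).@[(V y)^~ 0] != 0.
  move=> sS ys; rewrite mevalZ mulf_neq0 // rmorph_prod /= prodf_seq_neq0.
  apply/allP => x xs /=; apply: line_form_other_line => //;
    first exact: (S_sphere pG eS (sS _ xs)).
  by apply: contraNneq ys => <-.
have [yS|yS] := boolP (y \in S i).
  exists (c *: \prod_(x <- rem y (S i)) line_form (V x)); split.
  - by rewrite e (big_rem y yS) /= expr1 scalerAr.
  - by apply/rpredZ; rewrite subn1 -(size_rem yS); exact: line_form_prod_homog.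
  - apply: nz; first by move=> x /mem_rem.
    by rewrite mem_rem_uniqF // fset_uniq.
exists (P i); split; rewrite ?expr0 ?mul1r ?subn0 //; first exact: ground_homog.
by rewrite e; exact: nz.
Qed.

Lemma binary_unit g : binary Gamma g -> g \in unitmx.
Proof. by case=> /SU2_unit. Qed.

(** The action permutes the zeros of P_i, so poly_act g (P i) is again a ground
    form of S_i, and these are proportional. *)
Lemma ground_semi_invariant g i : binary Gamma g ->
  exists c, poly_act g (P i) = c *: P i.
Proof.
move=> [sg gG]; have sg' := SU2_adj sg.
have [|c e] := vanishing_form (poly_act_homog g (ground_homog i)).
  move=> x xS; rewrite poly_actE; have sx := S_sphere pG eS xS.
  have gx : invmx (so3_of g) *m x \in S i.
    by apply: (S_act pG eS) => //; exact: (inv_in_Gamma pG).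
  case: (hP i) => _ _ /(_ _ (invmx g *m V x) gx) h.
  apply: h.
  have -> : invmx (so3_of g) = so3_of (invmx g).
    rewrite SU2_inv // -[RHS](mulKmx (Gamma_unit pG gG)) -so3_ofM // SU2_mul1
      //.
    by rewrite so3_of1 mulmx1.
  rewrite SU2_inv //; apply: line_so3 => //.
  by case: (hV sx).
have [c' c'0 e'] := ground_factor i.
by exists (c / c'); rewrite e e' scalerA divfK.
Qed.

Lemma ground_weight g i x z : binary Gamma g -> on_sphere x ->
  g *m V x = z *: V x ->
  poly_act g (P i) = z ^ (2 * (x \in S i)%:Z - #|` S i|%:Z) *: P i.
Proof.
move=> bg sx gx; have [c e] := ground_semi_invariant i bg;
  have [q [pq hq qx]] := ground_order i sx.
have [x0 _] := hV sx; rewrite e; congr (_ *: _).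
apply: (semi_invariant_weight (proj2 (proj1 bg)) x0 gx _ pq hq qx e).
by case xS: (x \in S i) => //; rewrite cardfs_gt0; apply/fset0Pn; exists x.
Qed.

(** The axis of the rotation of g is exceptional unless this rotation is
    trivial, in which case any exceptional point is fixed; i provides one. *)
Lemma binary_fixes_exceptional (i : Omega) g : binary Gamma g ->
  exists i0 x z, x \in S i0 /\ g *m V x = z *: V x.
Proof.
move=> [sg gG].
have [i0 [x [xS gx]]] : exists i0 x, x \in S i0 /\ so3_of g *m x = x.
  have [g1|g1] := eqVneq (so3_of g) 1%:M.
    by have [x xS] := S_nonempty pG eS i; exists i, x; rewrite g1 mul1mx.
  have [x sx gx] := rotation_axis (Gamma_SO3 pG gG).
  by have [i0 xS] := S_cover_fix pG eS sx gG g1 gx; exists i0, x.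
have [x0 lx] := hV (S_sphere pG eS xS).
by have [z gz] := eigenline_of_fixed sg x0 lx gx; exists i0, x, z.
Qed.

End GroundForms.

(** * Homogeneous elements of the localisation *)

Section LocHomog.
Variable R : realType.
Local Notation C := R[i].
Variables (Q : {mpoly C[2]}) (dQ : nat).
Hypotheses (Q0 : Q != 0) (hQ : Q \is dQ.-homog).
Implicit Types (k : int) (f : {fraction {mpoly C[2]}}).

Lemma loc_homogP k f : loc_homog Q k f <->
  exists p n e, [/\ p \is e.-homog, k = e%:Z - (n * dQ)%N%:Z & f =
    p%:F / Q%:F ^+ n].
Proof.
split=> [[p [n [e [d [hp hd kE fE]]]]]|[p [n [e [hp kE fE]]]]].
  by exists p, n, e; rewrite -(dhomog_uniq Q0 hd hQ).
by exists p, n, e, dQ.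
Qed.

Lemma loc_homog_form p e : p \is e.-homog -> loc_homog Q e%:Z p%:F.
Proof.
by move=> hp; apply/loc_homogP; exists p, 0%N, e;
  rewrite mul0n subr0 expr0 divr1.
Qed.

Lemma mul_localised (F : fieldType) (a b c : F) n m :
  (a / c ^+ n) * (b / c ^+ m) = a * b / c ^+ (n + m).
Proof. by rewrite mulf_div exprD. Qed.

(** The exponent of t collects the denominator t^n and the divisors t^z and t^r;
    A is the part that cancels. *)
Lemma localised_quotient (F : fieldType) (A w t : F) (n r : nat) (z : int) :
  t != 0 -> A != 0 ->
  A * w / t ^+ n / (t ^ z * (t ^+ r * A)) = w * t ^ (- (n%:Z + z + r%:Z)).
Proof.
move=> t0 A0; rewrite -invr_expz !expfzDr // -!exprnP.
have u0 := expfz_neq0 z t0; have n0 := expf_neq0 n t0;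
  have r0 := expf_neq0 r t0.
by move: (t ^ z) (t ^+ n) (t ^+ r) u0 n0 r0 => u a b u0 a0 b0; field;
  rewrite u0 a0 b0 A0.
Qed.

Lemma loc_homogM k1 k2 f1 f2 : loc_homog Q k1 f1 -> loc_homog Q k2 f2 ->
  loc_homog Q (k1 + k2) (f1 * f2).
Proof.
move=> /loc_homogP [p1 [n1 [e1 [h1 -> ->]]]] /loc_homogP
  [p2 [n2 [e2 [h2 -> ->]]]].
apply/loc_homogP; exists (p1 * p2), (n1 + n2)%N, (e1 + e2)%N; split.
- exact: dhomogM.
- by rewrite mulnDl !PoszD; ring.
- by rewrite tofracM mul_localised.
Qed.

Lemma loc_homogXz (z : int) : loc_homog Q (z * dQ%:Z) (Q%:F ^ z).
Proof.
case: z => n.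
  by rewrite -exprnP -tofracXn -PoszM mulnC; apply/loc_homog_form/dhomogMn.
apply/loc_homogP; exists 1, n.+1, 0%N; split; first exact: dhomog1.
  by rewrite NegzE mulNr sub0r PoszM.
by rewrite NegzE -invr_expz tofrac1 mul1r.
Qed.

(** Zero has every degree; k may be negative, which requires a denominator. *)
Lemma loc_homog0 k : (0 < dQ)%N -> loc_homog Q k 0.
Proof.
(* A denominator Q^|k| makes the numerator degree k + |k| dQ nonnegative. *)
move=> d0; apply/loc_homogP; exists 0, (absz k),
  (absz (k + (absz k * dQ)%N%:Z)); split.
- exact: dhomog0.
- rewrite gez0_abs ?addrK // ; case: k => k /=; first by rewrite -PoszD.
  by rewrite NegzE addrC subr_ge0 lez_nat leq_pmulr.
- by rewrite tofrac0 mul0r.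
Qed.

Lemma loc_homog_prod (I : finType) (f : I -> {fraction {mpoly C[2]}})
  (k : I -> int) :
  (forall i, loc_homog Q (k i) (f i)) -> loc_homog Q (\sum_i k i) (\prod_i f i).
Proof.
move=> h; apply: (big_rec2 (fun k f => loc_homog Q k f)).
  by rewrite -tofrac1; apply: (@loc_homog_form 1 0); exact: dhomog1.
by move=> i f' k' _; apply: loc_homogM.
Qed.

End LocHomog.

(** * Invariants of even degree *)

Section Generator.
Local Open Scope fset_scope.
Local Open Scope ring_scope.
Variable R : realType.
Local Notation C := R[i].
Variables (Gamma : {fset 'M[R]_3}) (Omega : finType)
  (S : Omega -> {fset 'cV[R]_3}).
Variables (nu : Omega -> nat) (P : Omega -> {mpoly C[2]}) (j : Omega).
Hypothesis pG : polyhedral Gamma.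
Hypothesis eS : exceptional_orbits Gamma S.
Hypothesis hnu : forall i x, x \in S i -> #|` stab Gamma x| = nu i.
Hypothesis hP : forall i, ground_form (S i) (P i).
Variable V : 'cV[R]_3 -> 'cV[C]_2.
Hypothesis hV : forall x, on_sphere x -> V x != 0 /\ line_of x (V x).
Implicit Types (x y : 'cV[R]_3) (p q : {mpoly C[2]})
  (f : {fraction {mpoly C[2]}}).

Let Px0 i : P i != 0. Proof. exact: (ground_neq0 hP). Qed.
Let PF0 i : (P i)%:F != 0. Proof. by rewrite tofrac_eq0. Qed.

Lemma S_card_gt0 i : (0 < #|` S i|)%N.
Proof.
by rewrite cardfs_gt0; apply/fset0Pn; have [x xS] := S_nonempty pG eS i;
  exists x.
Qed.

(** The lines of all the points of the orbits S_i are distinct, so the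
    divisibility can be checked line by line. *)
Lemma forms_dvd (I : seq Omega) (r : Omega -> nat) e p : uniq I ->
  p \is e.-homog ->
  (forall i x, i \in I -> x \in S i -> exists q, p = line_form (V x) ^+ r i * q)
    ->
  exists q e', p = \prod_(i <- I) P i ^+ r i * q /\ q \is e'.-homog.
Proof.
move=> uI hp hd; pose s := [seq (i, x) | i <- I, x <- (S i : seq _)].
have sP t : t \in s -> t.1 \in I /\ t.2 \in S t.1.
  by case/allpairsPdep => i [x [iI xS ->]].
have us : uniq s.
  apply: allpairs_uniq_dep => // [i _|]; first exact: fset_uniq.
  by move=> [i x] [k y] _ _ /= [-> ->].
have sS t : t \in s -> on_sphere t.2 by move=> /sP [_]; exact: (S_sphere pG eS).
have Vn : {in s, forall t, V t.2 != 0} by move=> t /sS /hV [].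
have Vl : {in s &, forall t u, t != u ->
  (line_form (V t.2)).@[(V u.2)^~ 0] != 0}.
  move=> t u ts us' tu; apply: (line_form_other_line hV);
    [exact: sS|exact: sS|].
  apply: contra_neq tu; move: (sP _ ts) (sP _ us');
    case: t u {ts us'} => [i x] [k y] /=.
  by move=> [_ xi] [_ yk] e'; rewrite e' in xi *; rewrite (S_inj pG eS xi yk).
have pl : {in s, forall t, exists q, p = line_form (V t.2) ^+ r t.1 * q}.
  by move=> t /sP [tI tS]; exact: hd.
have [q pq hq] := line_form_prod_dvd (m := fun t => r t.1) us Vn Vl hp pl.
rewrite big_allpairs_dep /= in pq.
have [c c0 ec] : exists2 c, c != 0 &
    \prod_(i <- I) P i ^+ r i = c *: \prod_(i <- I) \prod_(x <- S i) line_form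
      (V x) ^+ r i.
  elim: (I) => [|i I' [c c0 IH]].
    by exists 1; rewrite ?oner_neq0 // !big_nil scale1r.
  have [ci ci0 ei] := ground_factor pG eS hP hV i.
  exists (ci ^+ r i * c); first by rewrite mulf_neq0 // expf_neq0.
  rewrite !big_cons IH {1}ei exprZn -scalerAl -scalerAr scalerA prodrXl.
  by [].
exists (c^-1 *: q), (e - \sum_(t <- s) r t.1)%N; split; last exact/rpredZ.
by rewrite ec -scalerAl -scalerAr scalerA divff // scale1r.
Qed.

Variable m : int.
Let rn i : nat := `|(m %% (nu i)%:Z)%Z|%N.
Let nu0 i : (0 < nu i)%N. Proof. exact: ltnW (nu_gt1 pG eS hnu i). Qed.
Let rnE i : (m %% (nu i)%:Z)%Z = (rn i)%:Z.
Proof. by rewrite /rn gez0_abs // modz_ge0 // eqz_nat -lt0n. Qed.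

Let d i := #|` S i|.
Let N := #|` Gamma|.
Let c : int := 2 * m - \sum_i (rn i)%:Z * (d i)%:Z.
Let l : int := (c %/ N%:Z)%Z.

Let N0 : (0 < N)%N.
Proof.
by rewrite cardfs_gt0; apply/fset0Pn; exists 1%:M; exact: one_in_Gamma.
Qed.

Let dnu i : (d i * nu i)%N = N. Proof. exact: orbit_stabilizer. Qed.

(** The exponent l of the generator is an integer. *)
Lemma card_dvd_degree : (N%:Z %| c)%Z.
Proof.
have := residue_degree m N0 dnu nu0 (riemann_hurwitz pG eS hnu).
by under eq_bigr do rewrite rnE.
Qed.

Let cl : (nu j)%:Z * l * (d j)%:Z = c.
Proof.
by rewrite mulrAC -PoszM mulnC dnu mulrC divzK //; exact: card_dvd_degree.
Qed.

Definition generator : {fraction {mpoly C[2]}} :=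
  (P j)%:F ^ ((nu j)%:Z * l) * \prod_i (P i)%:F ^+ rn i.

Lemma generator_neq0 : generator != 0.
Proof.
rewrite mulf_neq0 ?expfz_neq0 //; apply/prodf_neq0 => i _; exact: expf_neq0.
Qed.

(** P_j^(nu_j l) has degree |Gamma| l = c, which completes the degree of the
    other factors to 2m. *)
Lemma generator_loc : loc_homog (P j) (2 * m) generator.
Proof.
have hj := ground_homog hP j.
have -> : 2 * m = (nu j)%:Z * l * (d j)%:Z + \sum_i (rn i)%:Z * (d i)%:Z.
  by rewrite cl /c subrK.
apply: (loc_homogM (Px0 j) hj); first exact: loc_homogXz.
apply: (loc_homog_prod (Px0 j) hj) => i.
rewrite -PoszM mulnC -tofracXn; apply: (loc_homog_form (Px0 j) hj).
by apply/dhomogMn; exact: ground_homog.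
Qed.

(** An element g fixes an exceptional point, of S_i0 say, with eigenvalue z. The
    multiplier of the generator is z^2 to the power of its order minus m; this
    order is congruent to m modulo nu_i0, and z^2 is a root of unity of order
    dividing nu_i0. *)
Lemma generator_inv g : binary Gamma g -> frac_act g generator = generator.
Proof.
move=> bg; have gu := binary_unit bg.
have [i0 [x [z [xS gx]]]] := binary_fixes_exceptional pG eS hV j bg.
have sx := S_sphere pG eS xS; have [x0 lx] := hV sx.
have z0 := eigen_neq0 (proj2 (proj1 bg)) x0 gx.
have sP i : semi_invariant g (P i)%:F (z ^ (2 * (x \in S i)%:Z - (d i)%:Z)).
  by apply: semi_invariant_tofrac => //; exact: (ground_weight pG eS hP hV).
have xSi i : (x \in S i) = (i == i0).
  by apply/idP/eqP => [xi|-> //]; exact: (S_inj pG eS xi xS).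
have := semi_invariantM gu (semi_invariantXz ((nu j)%:Z * l) gu (sP j))
  (semi_invariant_prod gu (fun i => semi_invariantXn (rn i) gu (sP i))).
rewrite -/generator; set cc := (X in semi_invariant _ _ X).
suff -> : cc = 1 by rewrite /semi_invariant [scalar_frac 1]rmorph1 mul1r.
have [zr _] := stab_roots pG sx x0 lx.
have := zr g z bg gx; rewrite (hnu xS) => zn.
have ccE : cc = z ^ ((2 * (x \in S j)%:Z - (d j)%:Z) * ((nu j)%:Z * l)
    + \sum_i (2 * (x \in S i)%:Z - (d i)%:Z) * (rn i)%:Z).
  rewrite expfzDr // -exprz_exp /cc; congr (_ * _).
  rewrite (big_morph (fun e => z ^ e) (id1 := 1) (op1 := *%R)) //; last first.
    by move=> a b; rewrite expfzDr.
  by apply: eq_bigr => i _; rewrite -exprz_exp.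
have E : (2 * (x \in S j)%:Z - (d j)%:Z) * ((nu j)%:Z * l)
    + \sum_i (2 * (x \in S i)%:Z - (d i)%:Z) * (rn i)%:Z =
   2 * ((nu i0)%:Z * ((j == i0)%:Z * l - (m %/ (nu i0)%:Z)%Z)).
  have -> : \sum_i (2 * (x \in S i)%:Z - (d i)%:Z) * (rn i)%:Z =
      2 * (rn i0)%:Z - \sum_i (rn i)%:Z * (d i)%:Z.
    under eq_bigr do rewrite mulrBl xSi [(d _)%:Z * _]mulrC.
    rewrite sumrB; congr (_ - _); rewrite (bigD1 i0) //= eqxx mulr1 big1 ?addr0
      // => i.
    by move=> /negPf ->; rewrite mulr0 mul0r.
  rewrite xSi mulrBl [(d j)%:Z * _]mulrC cl.
  have -> : \sum_i (rn i)%:Z * (d i)%:Z = 2 * m - c by rewrite /c; ring.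
  have -> : 2 * m = 2 * ((m %/ (nu i0)%:Z)%Z * (nu i0)%:Z + (rn i0)%:Z).
    by rewrite -rnE -divz_eq.
  have [<-|_] := eqVneq j i0; rewrite /=; ring.
rewrite ccE E -!exprz_exp.
have -> : z ^ 2 = z ^+ 2 by [].
by have -> : (z ^+ 2) ^ (nu i0)%:Z = 1 by []; rewrite exp1rz.
Qed.

(** As the quotient is invariant, its numerator has the multiplier of its
    denominator. *)
Lemma numerator_weight p n :
  (forall g, binary Gamma g -> frac_act g (p%:F / (P j)%:F ^+ n) =
    p%:F / (P j)%:F ^+ n) ->
  forall g x z, binary Gamma g -> on_sphere x -> g *m V x = z *: V x ->
  poly_act g p = (z ^ (2 * (x \in S j)%:Z - (d j)%:Z)) ^+ n *: p.
Proof.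
move=> hf g x z bg sx gx; have gu := binary_unit bg.
have sP : semi_invariant g (P j)%:F (z ^ (2 * (x \in S j)%:Z - (d j)%:Z)).
  by apply: semi_invariant_tofrac => //; exact: (ground_weight pG eS hP hV).
have s1 : semi_invariant g (p%:F / (P j)%:F ^+ n) 1.
  by rewrite /semi_invariant hf // [scalar_frac 1]rmorph1 mul1r.
have := semi_invariantM gu s1 (semi_invariantXn n gu sP).
rewrite divfK ?expf_neq0 // mul1r /semi_invariant frac_act_tofrac // -tofracZ =>
  /eqP.
by rewrite tofrac_eq => /eqP.
Qed.

(** Let a be the order of p at x. P_j does not vanish at x, so the weights of p
    and of P_j^n give z^(2 (a - m)) = 1 for every g fixing x. By stab_roots a is
    congruent to m modulo nu_i, and a nonnegative number is at least its
    residue. *)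
Lemma order_ge_residue p n e : p != 0 -> p \is e.-homog ->
  2 * m = e%:Z - (n * d j)%N%:Z ->
  (forall g, binary Gamma g -> frac_act g (p%:F / (P j)%:F ^+ n) =
    p%:F / (P j)%:F ^+ n) ->
  forall i x, i != j -> x \in S i -> exists q, p = line_form (V x) ^+ rn i * q.
Proof.
move=> p0 hp kE hf i x ij xS; have sx := S_sphere pG eS xS;
  have [x0 lx] := hV sx.
have [a [q [pq ae hq qx]]] := homog_order x0 p0 hp.
suff ra : (rn i <= a)%N.
  by exists (line_form (V x) ^+ (a - rn i) * q); rewrite mulrA -exprD subnKC.
have [_ zN] := stab_roots pG sx x0 lx.
have : ((nu i)%:Z %| a%:Z - m)%Z.
  rewrite -(hnu xS); apply: zN => g z bg gx.
  have z0 := eigen_neq0 (proj2 (proj1 bg)) x0 gx.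
  have h := semi_invariant_weight (proj2 (proj1 bg)) x0 gx ae pq hq qx
    (numerator_weight hf bg sx gx).
  have xj : x \in S j = false.
    by apply/negbTE; apply: contra ij => xj; rewrite (S_inj pG eS xS xj).
  rewrite xj mulr0 sub0r in h.
  have e1 : z ^+ 2 = z ^ 2 by [].
  rewrite e1 exprz_exp mulrBr kE.
  have -> : 2 * a%:Z - (e%:Z - (n * d j)%N%:Z) = (2 * a%:Z - e%:Z) + d j * n.
    by rewrite PoszM; ring.
  rewrite expfzDr // -h exprnP exprz_exp -expfzDr //.
  by rewrite (_ : _ + _ = 0) ?expr0z //; ring.
rewrite -eqz_mod_dvd => /eqP am.
have : ((rn i)%:Z <= a%:Z).
  rewrite -rnE -am; have := divz_eq a%:Z (nu i)%:Z.
  have : 0 <= (a%:Z %/ (nu i)%:Z)%Z by rewrite divz_ge0 // ltz_nat nu0.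
  by move=> h0 h1; rewrite [leRHS]h1 lerDr mulr_ge0.
by rewrite lez_nat.
Qed.

(** The quotient of an invariant f by the generator stays in the localisation:
    the numerator of f is divisible by the powers of the P_i for i <> j, and the
    powers of P_j are units. *)
Lemma loc_inv_even : loc_inv (P j) Gamma (2 * m) =
  [set h * generator | h in loc_inv (P j) Gamma 0]%classic.
Proof.
have hj := ground_homog hP j.
apply/seteqP; split=> [f [lf invf]|_ [h [lh invh] <-]] /=; last first.
  split; first by rewrite -[2 * m]add0r;
    exact: (loc_homogM (Px0 j) hj lh generator_loc).
  by move=> g bg; rewrite frac_actM ?(binary_unit bg) // invh // generator_inv.
exists (f / generator); last by rewrite divfK // generator_neq0.
split; last first.
  move=> g bg; have gu := binary_unit bg.
  by rewrite frac_actM // frac_actV // invf // generator_inv.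
have := lf => /(loc_homogP (Px0 j) hj) [p [n [e [hp kE fE]]]].
have [p0|p0] := eqVneq p 0.
  by rewrite fE p0 tofrac0 !mul0r; apply: (loc_homog0 (Px0 j) hj);
    exact: S_card_gt0.
rewrite fE in invf.
have [q [e' [pq hq]]] : exists q e', p =
  \prod_(i <- rem j (enum Omega)) P i ^+ rn i * q /\ q \is e'.-homog.
  apply: (forms_dvd _ hp); first by rewrite rem_uniq // enum_uniq.
  move=> i x; rewrite mem_rem_uniq ?enum_uniq // inE => /andP[ij _].
  exact: (order_ge_residue p0 hp kE invf).
have q0 : q != 0 by apply: contra_neq p0; rewrite pq => ->; rewrite mulr0.
pose D := (\sum_(i <- rem j (enum Omega)) d i * rn i)%N.
have hD : \prod_(i <- rem j (enum Omega)) P i ^+ rn i \is D.-homog.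
  rewrite /D; elim: (rem _ _) => [|i I IH]; first by rewrite !big_nil dhomog1.
  by rewrite !big_cons; apply: (dhomogM _ IH); apply/dhomogMn/(ground_homog hP).
have eD : e = (D + e')%N.
  by apply: (dhomog_uniq p0 hp); rewrite pq; exact: dhomogM.
have jO : j \in enum Omega by rewrite mem_enum.
have sumE : \sum_i (rn i)%:Z * (d i)%:Z = (rn j)%:Z * (d j)%:Z + D%:Z.
  rewrite -big_enum /= (big_rem j jO) /=; congr (_ + _).
  rewrite /D (big_morph Posz PoszD (erefl _)); apply: eq_bigr => i _.
  by rewrite PoszM mulrC.
have -> : f / generator = q%:F * (P j)%:F ^
  (- (n%:Z + (nu j)%:Z * l + (rn j)%:Z)).
  rewrite fE /generator -big_enum /= (big_rem j jO) /= pq tofracM rmorph_prod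
    /=.
  under [X in X * q%:F]eq_bigr do rewrite tofracXn.
  have prodF0 : \prod_(i <- rem j (enum Omega)) (P i)%:F ^+ rn i != 0.
    by rewrite prodf_seq_neq0; apply/allP => i _; exact: expf_neq0.
  move: prodF0; set A := \prod_(i <- _) _ => A0.
  exact (@localised_quotient {fraction {mpoly C[2]}} A q%:F (P j)%:F n (rn j) _
    (PF0 j) A0).
have := loc_homogM (Px0 j) hj (loc_homog_form (Px0 j) hj hq)
  (loc_homogXz (Px0 j) hj (- (n%:Z + (nu j)%:Z * l + (rn j)%:Z))).
rewrite (_ : _ + _ = 0) //.
by rewrite mulNr !mulrDl cl /c sumE kE eD PoszD PoszM; ring.
Qed.

End Generator.

(** * Invariants of odd degree *)

Section OddDegree.
Local Open Scope fset_scope.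
Local Open Scope ring_scope.
Variable R : realType.
Local Notation C := R[i].

Lemma SU2_N1 : SU2 (- 1%:M : 'M[C]_2).
Proof. by apply: SU2N; exact: SU2_1. Qed.

Lemma binaryN1 (Gamma : {fset 'M[R]_3}) : polyhedral Gamma ->
  binary Gamma (- 1%:M : 'M[C]_2).
Proof.
move=> pG; split; first exact: SU2_N1.
by rewrite so3_ofN so3_of1; exact: one_in_Gamma.
Qed.

Lemma poly_actN1_X (a : 'I_2) : poly_act (- 1%:M) 'X_a = - 'X_a :> {mpoly C[2]}.
Proof.
rewrite poly_actX (SU2_inv SU2_N1) adjN trmx1 map_mx1 sum2E !mxE.
by case: (I2P a) => ->; rewrite /= oppr0 scale0r ?addr0 ?add0r scaleN1r.
Qed.

Lemma poly_actN1 (p : {mpoly C[2]}) e : p \is e.-homog ->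
  poly_act (- 1%:M) p = (-1) ^+ e *: p.
Proof.
move=> hp; rewrite [LHS]comp_mpolyEX [in RHS](mpolyE p) scaler_sumr.
apply: eq_big_seq => mm hmm; rewrite scalerA mulrC -scalerA; congr (_ *: _).
rewrite [LHS]comp_mpolyX mpolyXE_id -(dhomog_mf hp hmm) /= mdegE -prodrXr.
rewrite -scaler_prod; apply: eq_bigr => a _; rewrite -exprZn; congr (_ ^+ _).
by rewrite scaleN1r -poly_actN1_X [RHS]comp_mpolyXU -tnth_nth.
Qed.

(** An element of odd degree is changed into its opposite by - 1. *)
Lemma loc_inv_odd (Gamma : {fset 'M[R]_3}) (Q : {mpoly C[2]}) d k :
  polyhedral Gamma -> Q != 0 -> Q \is d.-homog -> (0 < d)%N -> ~~ (2 %| k)%Z ->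
  loc_inv Q Gamma k = [set 0]%classic.
Proof.
move=> pG Q0 hQ d0 kodd; apply/seteqP; split=> [f [lf invf]|_ ->] /=;
  last first.
  split; first exact: (loc_homog0 Q0 hQ).
  move=> g bg; rewrite -(tofrac0_div 1) frac_actE ?oner_neq0 ?(binary_unit bg)
    //.
  by rewrite [poly_act g 0]raddf0 !tofrac0_div.
have bg := binaryN1 pG; have gu := binary_unit bg.
have [p [n [e [hp kE fE]]]] := iffLR (loc_homogP Q0 hQ k f) lf.
have sp := semi_invariant_tofrac gu (poly_actN1 hp).
have sQ := semi_invariantV gu (semi_invariantXn n gu
  (semi_invariant_tofrac gu (poly_actN1 hQ))).
have := semi_invariantM gu sp sQ; rewrite -fE /semi_invariant invf //.
have -> : (-1) ^+ e / ((-1) ^+ d) ^+ n = -1 :> C.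
  rewrite -exprM invr_sign -exprD -signr_odd.
  have -> : odd (e + d * n) = true by move: kodd; rewrite kE; lia.
  by rewrite expr1.
move=> h; have : scalar_frac (1 + 1 : C) * f = 0.
  rewrite [scalar_frac _]rmorphD /= [scalar_frac 1]rmorph1 mulrDl mul1r {1}h.
  by rewrite [scalar_frac (-1)]rmorphN /= [scalar_frac 1]rmorph1 mulN1r addNr.
move/eqP; rewrite mulf_eq0 => /orP[|/eqP //].
by rewrite fmorph_eq0 -mulr2n pnatr_eq0.
Qed.

End OddDegree.

(** * The modules of invariants *)

Theorem theorem2p1 (R : realType) (Gamma : {fset 'M[R]_3}) (Omega : finType)
    (S : Omega -> {fset 'cV[R]_3}) (nu : Omega -> nat)
    (P : Omega -> {mpoly R[i][2]}) (j : Omega) :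
  polyhedral Gamma ->
  exceptional_orbits Gamma S ->
  (forall i x, x \in S i -> #|` stab Gamma x| = nu i) ->
  (forall i, ground_form (S i) (P i)) ->
  let res i (m : int) := (m %% (nu i)%:Z)%Z in
  (forall k : int, (2 %| k)%Z ->
     let m := (k %/ 2)%Z in
     let c := k - \sum_i res i m * (#|` S i|)%:Z in
     let l := (c %/ (#|` Gamma|)%:Z)%Z in
     let Pk := (P j)%:F ^ ((nu j)%:Z * l) * \prod_i (P i)%:F ^ res i m in
     ((#|` Gamma|)%:Z %| c)%Z /\
     loc_inv (P j) Gamma k = [set h * Pk | h in loc_inv (P j) Gamma 0]) /\
  (forall k : int, ~~ (2 %| k)%Z -> loc_inv (P j) Gamma k = [set 0]).
Proof.
move=> pG eS hnu hP res; split; last first.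
  move=> k kodd; apply: (loc_inv_odd pG (ground_neq0 hP j) (ground_homog hP j) _ kodd).
  exact: (S_card_gt0 pG eS).
have [V hV] : {V : 'cV[R]_3 -> 'cV[R[i]]_2 &
    forall x, on_sphere x -> V x != 0 /\ line_of x (V x)}.
  apply: (@boolp.choice _ _ (fun x v => on_sphere x -> v != 0 /\ line_of x v)) => x.
  have [sx|nsx] := boolp.pselect (on_sphere x); last by exists 0.
  by have [v v0 lv] := line_exists sx; exists v.
move=> k keven m c l Pk1.
have km : k = 2 * m by rewrite /m mulrC divzK.
have rE i : res i m = `|(m %% (nu i)%:Z)%Z|%N :> int.
  rewrite /res gez0_abs // modz_ge0 // eqz_nat -lt0n.
  exact: ltnW (nu_gt1 pG eS hnu i).
have cE : c = 2 * m - \sum_i `|(m %% (nu i)%:Z)%Z|%N%:Z * #|` S i|%:Z.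
  by rewrite /c km; congr (_ - _); apply: eq_bigr => i _; rewrite -rE.
split; first by rewrite cE; exact: (card_dvd_degree pG eS hnu).
rewrite [in LHS]km (loc_inv_even j pG eS hnu hP hV).
suff -> : Pk1 = generator Gamma S nu P j m by [].
rewrite /Pk1 /generator /l cE; congr (_ * _).
by apply: eq_bigr => i _; rewrite rE.
Qed.
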